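(* For all integers $N\ge 2$ and $n\ge 1$, $$(N^{2n}-1)\zeta(2n)=\frac{\pi^{2n}}{2(2n-1)!}\sum_{i=1}^{n}a_{n,i}\,\zeta_{\mathbb{Z}/N\mathbb{Z}}(i)$$ and $$\zeta_{\mathbb{Z}/N\mathbb{Z}}(n)=2\sum_{i=1}^{n}c_{n,i}\frac{N^{2i}-1}{\pi^{2i}}\zeta(2i).$$
   Context: $\zeta$ is the Riemann zeta function. The spectral zeta function of the cycle graph $\mathbb{Z}/N\mathbb{Z}$ is $$\zeta_{\mathbb{Z}/N\mathbb{Z}}(s)=\sum_{m=1}^{N-1}\frac{1}{\sin^{2s}(m\pi/N)}.$$ $c_{n,i}$ is the coefficient of $x^{-2i}$ in the Laurent expansion of $(\sin x)^{-2n}$ at $x=0$. For $1\le i\le n$, $$a_{n,i}=2\sum_{l=1}^{i}(-1)^{n-l}\,t(n-l,n-i)\,\overline{A}(2n,l),$$ where for integers $0\le i\le k$ with $k\ge1$, $t(k,i)=(-1)^{k-i}2^{2i}\frac{k}{k+i}\binom{k+i}{k-i}$, and by convention $t(0,0)=\frac12$. A circular $n$-permutation is an arrangement $\sigma=(\sigma(1),\dots,\sigma(n))$ of $\{1,\dots,n\}$ on a circle, considered up to rotation; with $\sigma(n+1)=\sigma(1)$, a descent of $\sigma$ is an entry $\sigma(i)$, $1\le i\le n$, with $\sigma(i)>\sigma(i+1)$. $\overline{A}(n,l)$ denotes the number of circular $n$-permutations with exactly $l$ descents. *)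

(* Defs.v *)
(* MathComp-Analysis, over an arbitrary realType. *)
From mathcomp Require Import all_boot all_order all_algebra all_fingroup.
From mathcomp Require Import all_classical all_reals all_analysis.
Set Implicit Arguments.
Unset Strict Implicit.
Unset Printing Implicit Defensive.
Import Order.TTheory GRing.Theory Num.Theory.
Import numFieldNormedType.Exports.
Local Open Scope classical_set_scope.
Local Open Scope ring_scope.

(* Dirichlet series, hence the Riemann zeta function only for 1 < s (the
   sequence is indexed from 0, whence the shift). *)
Definition zeta {R : realType} (s : R) : R :=
  limn (series (fun k : nat => (k.+1%:R `^ s)^-1 : R)).

(* For 0 < m < N the base sin (m pi / N) is positive, so that the power is the
   usual one for every real s. *)
Definition cycle_zeta {R : realType} (N : nat) (s : R) : R :=
  \sum_(1 <= m < N) (sin (m%:R * pi / N%:R) `^ (2 * s))^-1.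

(* b lists the coefficients of a Laurent expansion of f at 0 with finite
   principal part, i.e. 0 is at worst a pole; such a b is unique. *)
Definition is_laurent {R : realType} (f : R -> R) (b : int -> R) : Prop :=
  exists p : nat, (forall k : int, k < - p%:Z -> b k = 0) /\
  exists2 r : R, 0 < r & forall x : R, 0 < `|x| < r ->
    series (fun j : nat => b (j%:Z - p%:Z) * x ^ (j%:Z - p%:Z)) @ \oo --> f x.

(* The default value 0 is only used when there is no expansion. *)
Definition laurent_coef {R : realType} (f : R -> R) : int -> R :=
  xget (fun=> 0) [set b | is_laurent f b].

Definition csc_coef (R : realType) (n i : nat) : R :=
  laurent_coef (fun x : R => (sin x) ^- (2 * n)) (- (2 * i)%:Z).

(* An arrangement of n labels on a circle is a permutation of 'I_n (labels and
   positions are shifted to 0, ..., n - 1); ordS is the cyclic successor. *)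
Definition cyclic_descents {n : nat} (s : 'S_n) : nat :=
  #|[set i : 'I_n | (s (ordS i) < s i)%N]%SET|.

Definition rotation_equiv {n : nat} : rel 'S_n :=
  fun s t => [exists k : 'I_n, [forall i : 'I_n, t i == s (iter k (@ordS n) i)]].

(* The number of circular n-permutations with l descents: rotation classes of
   arrangements (the number of cyclic descents is invariant under rotation). *)
Definition circ_eulerian (n l : nat) : nat :=
  #|equivalence_partition (@rotation_equiv n)
      [set s : 'S_n | cyclic_descents s == l]%SET|.

(* Meant for i <= k; the value at k = 0 is a convention. *)
Definition tcoef (R : realType) (k i : nat) : R :=
  if k == 0%N then 2^-1
  else (-1) ^+ (k - i) * 2 ^+ (2 * i) * (k%:R / (k + i)%:R)
       * 'C(k + i, k - i)%:R.

Definition acoef (R : realType) (n i : nat) : R :=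
  2 * \sum_(1 <= l < i.+1)
        (-1) ^+ (n - l) * tcoef R (n - l) (n - i) * (circ_eulerian (2 * n) l)%:R.

(* Main.v *)
(* Put f_n(x) = sum_i a_{n,i} csc^{2i} x. Inserting the largest label gives a
   recursion for circular Eulerian numbers; with the contiguity relations of
   the Chebyshev coefficients t(k,i) it says that f_1 = csc^2 and
   f_{n+1} = f_n''. Since csc^2 x + csc^2 (x + pi/2) = 4 csc^2 (2x),
   f_n(x) + f_n(x + pi/2) = 4^n f_n(2x). Hence Q(N) = sum_m f_n(m pi/N)
   satisfies Q(2N) = Q(2) + 4^n Q(N), so that S(N) = Q(N) + Q(2)/(4^n - 1) is
   multiplied by 4^n when N is doubled and S(N)/N^{2n} is equal to its limit,
   which x^-2 <= csc^2 x <= x^-2 + 1 identifies as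
   2 (2n-1)! zeta(2n)/pi^{2n}; as Q(1) = 0 this yields the first identity. The
   same doubling formula kills every term of the principal part of f_n at 0
   except (2n-1)! x^{-2n}. Thus the triangular matrices (a_{n,i}) and (c_{n,i})
   are inverse to each other up to factorials, and the second identity follows
   from the first. *)
Require Import Defs.
From mathcomp Require Import all_boot all_order all_algebra all_fingroup.
From mathcomp Require Import all_classical all_reals all_analysis.
From mathcomp Require Import zify ring lra.
Set Implicit Arguments.
Unset Strict Implicit.
Unset Printing Implicit Defensive.
Import Order.TTheory GRing.Theory Num.Theory.
Import numFieldNormedType.Exports.
Local Open Scope ring_scope.

(** * Circular Eulerian numbers *)

Section CircularEulerian.
Local Open Scope nat_scope.

(** No second derivative is taken analytically. For y = csc^2 x one has y'^2 = 4 y^2 (y - 1) and y''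
    = 6 y^2 - 4 y, so differentiating twice is a formal operator on polynomials in y. The powers of
    csc^2 (2x) and the sums csc^{2i} x + csc^{2i} (x + pi/2), as polynomials in csc^2 (2x), obey the
    same rule under this operator, up to the factor 4 of the chain rule. The recursion of the
    a_{n,i} therefore combines both families alike, which is the doubling formula. It takes the
    place of the partial fraction expansion of csc^2 and its termwise derivatives, so that analysis
    is needed only for elementary inequalities. The obstacle on the combinatorial side is that
    a_{n,i} sums over l <= i only; symmetry turns it into a sum over all l, on which the recursion
    acts without boundary terms. Laurent coefficients are compared over the reals through principal
    parts alone, that is, polynomials q without constant term such that f(x) - q(1/x) stays bounded
    near 0. *)

Lemma iter_ordS n k (i : 'I_n) : iter k (@ordS n) i = (i + k) %% n :> nat.
Proof.
elim: k => [|k IHk] /=; first by rewrite addn0 modn_small.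
by rewrite IHk -addn1 modnDml -addnA addn1.
Qed.

Lemma rotation_equivP n (s t : 'S_n.+1) :
  reflect (exists k, forall i, t i = s (iter k (@ordS n.+1) i))
          (rotation_equiv s t).
Proof.
apply: (iffP existsP) => [[k /forallP tE]|[k tE]].
  by exists k => i; apply/eqP/tE.
exists (inord (k %% n.+1)); apply/forallP => i; rewrite tE; apply/eqP.
congr (s _); apply: val_inj; rewrite /= !iter_ordS inordK ?ltn_pmod //.
by rewrite modnDmr.
Qed.

Lemma rotation_equiv_equivalence n :
  equivalence_rel (@rotation_equiv n.+1).
Proof.
have sym s t : @rotation_equiv n.+1 s t -> rotation_equiv t s.
  move=> /rotation_equivP[k tE]; apply/rotation_equivP; exists (k * n) => i.
  rewrite tE -iterD; congr (s _); apply: val_inj; rewrite /= iter_ordS.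
  by rewrite -mulnS addnC modnMDl modn_small.
have trans s t u : @rotation_equiv n.+1 s t -> rotation_equiv t u ->
    rotation_equiv s u.
  move=> /rotation_equivP[k tE] /rotation_equivP[l uE].
  by apply/rotation_equivP; exists (k + l) => i; rewrite uE tE iterD.
move=> s t u; split; first by apply/rotation_equivP; exists 0.
by move=> st; apply/idP/idP; [apply/trans/sym|apply/trans].
Qed.

Lemma cyclic_descents_rotation n (s t : 'S_n.+1) :
  rotation_equiv s t -> cyclic_descents t = cyclic_descents s.
Proof.
move=> /rotation_equivP[k tE]; rewrite /cyclic_descents.
have ordS_inj : injective (@ordS n.+1).
  exact: can_inj (@ordSK _).
have iter_inj : injective (iter k (@ordS n.+1)).
  by elim: (k) => //= m IHm; apply: inj_comp.
rewrite -[RHS](card_preimset _ iter_inj); apply: eq_card => i.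
by rewrite !inE !tE -iterS iterSr.
Qed.

(** Each rotation class contains exactly one arrangement with label 0 at position 0, so these
    arrangements form a transversal of the partition. *)
Lemma circ_eulerianE n l : circ_eulerian n.+1 l =
  #|[set s : 'S_n.+1 | (s ord0 == ord0) && (cyclic_descents s == l)]|.
Proof.
rewrite /circ_eulerian; set D := [set s | _]; symmetry.
have equivD : {in D & &, equivalence_rel (@rotation_equiv n.+1)}.
  by move=> s t u _ _ _; apply: rotation_equiv_equivalence.
apply: (@card_transversal _ _ _ D); apply/and3P; split.
- exact: equivalence_partitionP.
- by apply/fintype.subsetP => s; rewrite !inE => /andP[].
apply/forall_inP => B /imsetP[s Ds ->]; apply/eqP.
(* Rotating by the position of label 0 yields the representative of the class of [s]. *)
pose k : nat := (s^-1%g ord0).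
have rot_inj : injective (fun i => s (iter k (@ordS n.+1) i)).
  move=> i j /perm_inj /(congr1 val) /=; rewrite !iter_ordS => /eqP.
  by rewrite eqn_modDr !modn_small // => /eqP/val_inj.
have rE : rotation_equiv s (perm rot_inj).
  by apply/rotation_equivP; exists k => i; rewrite permE.
suff -> : [set s0 : 'S_n.+1 | (s0 ord0 == ord0) && (cyclic_descents s0 == l)]
    :&: [set t in D | rotation_equiv s t] = [set perm rot_inj].
  by rewrite cards1.
apply/finset.setP => t; rewrite !inE.
have s0 : s (iter k (@ordS n.+1) ord0) = ord0.
  rewrite (_ : iter _ _ _ = s^-1%g ord0) ?permKV //.
  by apply: val_inj; rewrite /= iter_ordS add0n modn_small // /k ltn_ord.
apply/idP/eqP => [/andP[/andP[/eqP t0 _] /andP[_ /rotation_equivP[m tE]]]|->].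
  have : s (iter m (@ordS n.+1) ord0) = s (iter k (@ordS n.+1) ord0).
    by rewrite -tE t0 s0.
  move=> /perm_inj/(congr1 val); rewrite /= !iter_ordS !add0n => mk.
  apply/permP => i; rewrite permE tE; congr (s _); apply: val_inj.
  by rewrite /= !iter_ordS -modnDmr mk modnDmr.
have := Ds; rewrite inE => /eqP Dl.
by rewrite permE s0 rE (cyclic_descents_rotation rE) Dl !eqxx.
Qed.

(** The new label sits at position j + 1: the step into it is an ascent, the step out of it a
    descent, and the two replace the gap after j. The count grows by one unless that gap was a
    descent already. *)
Lemma cyclic_descents_insert_max n (s : 'S_n.+1) (j : 'I_n.+1) :
  cyclic_descents (lift_perm (lift ord0 j) ord_max s) =
  cyclic_descents s + ~~ (s (ordS j) < s j).
Proof.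
rewrite /cyclic_descents -!sum1_card [in LHS]big_mkcond [in RHS]big_mkcond /=.
rewrite (@bigD1_ord _ _ _ _ (lift ord0 j)) //=.
rewrite (bigD1 j) //= [in RHS](bigD1 j) //=.
rewrite !inE lift_perm_id.
have -> : ordS (lift (lift ord0 j) j) = lift ord0 j.
  by apply: val_inj; rewrite /= /bump /= ltnn /= !add0n modn_small // ltnS.
have L k : lift ord_max k = k :> nat by rewrite /= /bump leqNgt ltn_ord.
have -> : (lift_perm (lift ord0 j) ord_max s (ordS (lift ord0 j))
    < (@ord_max n.+1)) = true.
  have -> : ordS (lift ord0 j) = lift (lift ord0 j) (ordS j).
    apply: val_inj => /=; rewrite /bump /= !add1n.
    have := ltn_ord j; rewrite leq_eqVlt ltnS => /orP[/eqP jn|jn].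
      by rewrite jn ?modnn ltn0 addn0.
    rewrite !modn_small ?ltnS //. lia.
  by rewrite lift_perm_lift L /= ltn_ord.
have -> : (lift_perm (lift ord0 j) ord_max s (lift ord0 j) <
    lift_perm (lift ord0 j) ord_max s (lift (lift ord0 j) j)) = false.
  by rewrite lift_perm_id lift_perm_lift L ltnNge ltnW // ltn_ord.
rewrite add0n /=.
rewrite addnC [in RHS]addnAC [in RHS]addnC; congr (_ + _); last by case: ifP.
apply: eq_bigr => k kj; rewrite !inE lift_perm_lift L.
have -> : ordS (lift (lift ord0 j) k) = lift (lift ord0 j) (ordS k).
  apply: val_inj => /=; rewrite /bump /= !add1n.
  have {}kj : k <> j :> nat by move/val_inj/eqP; rewrite (negbTE kj).
  have jn := ltn_ord j.
  have := ltn_ord k; rewrite leq_eqVlt ltnS => /orP[/eqP kn|kn].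
    by rewrite (_ : j < k) ?add1n ?kn ?modnn ?ltn0 //; lia.
  by rewrite !modn_small ?ltnS //; lia.
by rewrite lift_perm_lift L.
Qed.

(** Insertion at a descent keeps the number of descents and elsewhere raises it by one: l gaps of
    the former kind when it is l, n + 1 - (l - 1) of the latter when it is l - 1. The factor [0 < l]
    guards against [0.-1 = 0]. *)
Lemma card_ascent_gaps n (s : 'S_n.+1) l :
  #|[set j : 'I_n.+1 | cyclic_descents s + ~~ (s (ordS j) < s j) == l]| =
  (cyclic_descents s == l) * l +
  (cyclic_descents s == l.-1) * (n.+2 - l) * (0 < l).
Proof.
have cdE : #|[set j : 'I_n.+1 | s (ordS j) < s j]| = cyclic_descents s by [].
have cdC : #|~: [set j : 'I_n.+1 | s (ordS j) < s j]| = n.+1 - cyclic_descents s.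
  by rewrite cardsCs finset.setCK cdE card_ord.
have [dl|dl] := eqVneq (cyclic_descents s) l.
  rewrite mul1n [(_ == _.-1) * _ * _](_ : _ = 0); last first.
    by rewrite dl; case: (l) => [|m]; rewrite ?muln0 //= (gtn_eqF (ltnSn m)).
  transitivity #|[set j : 'I_n.+1 | s (ordS j) < s j]|.
    2: by rewrite cdE dl !addn0.
  apply: eq_card => j; rewrite !inE dl.
  by case: (s (ordS j) < s j); rewrite ?addn0 ?eqxx // addn1 gtn_eqF.
rewrite mul0n add0n; case: l dl => [|l] dl /=.
  rewrite muln0; apply/eqP; rewrite cards_eq0; apply/eqP/finset.setP => j.
  by rewrite !inE addn_eq0 (negbTE dl).
rewrite muln1; have [dl'|dl'] := eqVneq (cyclic_descents s) l.
  rewrite mul1n subSS.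
  transitivity #|~: [set j : 'I_n.+1 | s (ordS j) < s j]|.
    2: by rewrite cdC dl'.
  apply: eq_card => j; rewrite !inE dl'.
  by case: (s (ordS j) < s j); rewrite /= ?addn0 ?addn1 ?eqxx // ltn_eqF.
rewrite mul0n; apply/eqP; rewrite cards_eq0; apply/eqP/finset.setP => j.
rewrite !inE; case: (s (ordS j) < s j); rewrite /= ?addn0 ?(negbTE dl) //.
by rewrite addn1 eqSS (negbTE dl').
Qed.

(* A circular arrangement of n + 2 labels arises from exactly one of n + 1
   labels by inserting the largest label in one of the n + 1 gaps; this adds a
   descent exactly when the gap is an ascent. *)
Lemma circ_eulerian_rec n l : circ_eulerian n.+2 l =
  l * circ_eulerian n.+1 l + (0 < l) * (n.+2 - l) * circ_eulerian n.+1 l.-1.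
Proof.
pose ins (p : 'S_n.+1 * 'I_n.+1) : 'S_n.+2 :=
  lift_perm (lift ord0 p.2) ord_max p.1.
have ins_inj : injective ins.
  move=> [s j] [t k]; rewrite /ins /= => E.
  have jk : j = k.
    apply: (@lift_inj _ ord0); apply: (@perm_inj _ (ins (s, j))).
    by rewrite {2}/ins /= E !lift_perm_id.
  congr (_, _) => //; apply/permP => i.
  by apply: (@lift_inj _ ord_max); rewrite -!(lift_perm_lift (lift ord0 j)) E jk.
have fixL (s : 'S_n.+1) j : (ins (s, j) ord0 == ord0) = (s ord0 == ord0).
  have {1}-> : ord0 = lift (lift ord0 j) ord0 :> 'I_n.+2 by apply: val_inj.
  by rewrite lift_perm_lift -!val_eqE /= /bump leqNgt ltn_ord.
transitivity (#|[set p : 'S_n.+1 * 'I_n.+1 | (p.1 ord0 == ord0) &&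
    (cyclic_descents p.1 + ~~ (p.1 (ordS p.2) < p.1 p.2) == l)]|).
  rewrite circ_eulerianE -(card_imset _ ins_inj); apply: eq_card => s.
  rewrite !inE; apply/idP/imsetP => [/andP[s0 sl]|[[t j]]]; last first.
    rewrite inE /= => /andP[t0 tl] ->.
    by rewrite fixL t0 cyclic_descents_insert_max.
  have [j jE] : exists j, s (lift ord0 j) = ord_max.
    case: (unliftP ord0 (s^-1%g ord_max)) => [j E|E].
      by exists j; rewrite -E permKV.
    by have := permKV s ord_max; rewrite E (eqP s0).
  (* Deletion of the largest label; the default of [odflt] is never reached, since [ord_max] is
     taken at the removed position only. *)
  have t_inj : injective (fun i =>
      odflt ord0 (unlift ord_max (s (lift (lift ord0 j) i)))).
    move=> a b.
    have U i : exists2 c, s (lift (lift ord0 j) i) = lift ord_max c &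
       unlift ord_max (s (lift (lift ord0 j) i)) = Some c.
      case: unliftP => [c|]; first by exists c.
      by rewrite -jE => /perm_inj/eqP; rewrite eq_sym (negbTE (neq_lift _ _)).
    have [c Ec ->] := U a; have [d Ed ->] := U b => /= cd.
    by apply: (@lift_inj _ (lift ord0 j)); apply: (@perm_inj _ s); rewrite Ec cd Ed.
  have sE : s = ins (perm t_inj, j).
    apply/permP => i; case: (unliftP (lift ord0 j) i) => [k|] ->; last first.
      by rewrite lift_perm_id jE.
    rewrite lift_perm_lift permE; case: unliftP => //.
    by rewrite -jE => /perm_inj/eqP; rewrite eq_sym (negbTE (neq_lift _ _)).
  exists (perm t_inj, j) => //; rewrite inE /= -cyclic_descents_insert_max.
  by move: sE; rewrite -(fixL (perm t_inj) j) /ins /= => <-; rewrite s0.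
rewrite -sum1_card; under eq_bigl => p do rewrite inE.
rewrite -(pair_big_dep (fun s : 'S_n.+1 => s ord0 == ord0)
  (fun s j => cyclic_descents s + ~~ (s (ordS j) < s j) == l) (fun _ _ => 1)) /=.
under eq_bigr => s _.
  rewrite (eq_bigl (fun j => j \in [set j : 'I_n.+1 |
    cyclic_descents s + ~~ (s (ordS j) < s j) == l])).
    2: by move=> j; rewrite inE.
  rewrite sum1_card card_ascent_gaps; over.
rewrite big_split /= !circ_eulerianE -!sum1_card; congr (_ + _).
  rewrite big_distrr /= [LHS]big_mkcond [RHS]big_mkcond /=.
  apply: eq_bigr => s _; rewrite inE; case: ifP => //= _.
  by case: ifP => // _; rewrite ?mul1n ?muln1.
rewrite big_distrr /= [LHS]big_mkcond [RHS]big_mkcond /=.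
apply: eq_bigr => s _; rewrite inE; case: ifP => //= _.
by case: ifP => // _; rewrite ?mul1n ?muln1 mulnC.
Qed.

Lemma circ_eulerian1 l : circ_eulerian 1 l = (l == 0).
Proof.
rewrite circ_eulerianE.
rewrite (_ : [set s | _] = if l == 0 then [set: 'S_1]%SET else finset.set0).
  case: ifP => _; last by rewrite cards0.
  by rewrite cardsT card_Sn.
apply/finset.setP => s; rewrite !inE (ord1 (s ord0)) eqxx /=.
have -> : cyclic_descents s = 0.
  apply/eqP; rewrite cards_eq0; apply/eqP/finset.setP => i.
  by rewrite !inE !(ord1 (s _)) ltnn.
by rewrite eq_sym; case: ifP; rewrite !inE.
Qed.

Lemma circ_eulerian0 n : circ_eulerian n.+2 0 = 0.
Proof. by rewrite circ_eulerian_rec mul0n. Qed.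

Lemma circ_eulerian_gt n l : n < l -> circ_eulerian n.+1 l = 0.
Proof.
elim: n l => [|n IHn] l nl; first by rewrite circ_eulerian1 gtn_eqF.
rewrite circ_eulerian_rec IHn ?(ltnW nl) // muln0.
by case: l nl => // l nl; rewrite /= IHn ?muln0.
Qed.

(** Complementing l exchanges the two terms of the recursion, so the symmetry passes from one size
    to the next. *)
Lemma circ_eulerian_sym n l : l <= n.+2 ->
  circ_eulerian n.+2 (n.+2 - l) = circ_eulerian n.+2 l.
Proof.
elim: n l => [|n IHn] l ln.
  rewrite !circ_eulerian_rec !circ_eulerian1.
  by case: l ln => [|[|[|]]].
case: l ln => [|l] ln; first by rewrite subn0 circ_eulerian_gt ?circ_eulerian0.
rewrite subSS; move: ln; rewrite ltnS leq_eqVlt => /orP[/eqP ->|ln].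
  by rewrite subnn circ_eulerian0 circ_eulerian_gt.
rewrite !(circ_eulerian_rec n.+1) subn_gt0 ln !mul1n addnC /=.
have -> : (n.+2 - l).-1 = n.+2 - l.+1 by lia.
have -> : n.+3 - (n.+2 - l) = l.+1 by lia.
by rewrite !IHn ?(ltnW ln).
Qed.

End CircularEulerian.

(** * The coefficients a_{n,i} *)

(* cheb k j is up to the sign (-4)^j the coefficient of (sin x)^(2j) in
   2 cos (2 k x). *)
Definition cheb (R : pzRingType) (k j : nat) : R :=
  'C(k + j, 2 * j)%:R + 'C((k + j).-1, 2 * j)%:R.

Lemma bin_predM (R : comPzRingType) m r :
  m.+1%:R * 'C(m, r)%:R = (m.+1%:R - r%:R) * 'C(m.+1, r)%:R :> R.
Proof.
have [rm|mr] := leqP r m.+1; last by rewrite !bin_small ?mulr0 // ltnW.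
by rewrite -natrB // -!natrM mul_bin_down.
Qed.

(** Coefficient form of 2 cos(2(k+2)x) + 2 cos(2kx) = (2 - 4 sin^2 x) 2 cos(2(k+1)x). *)
Lemma cheb_second_difference (R : comPzRingType) k j :
  cheb R k.+2 j = 2 * cheb R k.+1 j - cheb R k j +
    (if j is i.+1 then cheb R k.+1 i else 0).
Proof.
case: j => [|j]; first by rewrite /cheb !muln0 !bin0; ring.
have P m r : 'C(m.+2, r.+2)%:R = 2 * 'C(m.+1, r.+2)%:R - 'C(m, r.+2)%:R
    + 'C(m, r)%:R :> R.
  by rewrite (binS m.+1 r.+1) (binS m r) (binS m r.+1) !natrD; ring.
rewrite /cheb !addSn !addnS /= (_ : 2 * j.+1 = (2 * j).+2)%N; last by lia.
by rewrite (P (k + j).+1) (P (k + j)); ring.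
Qed.

Lemma cheb_contiguity (R : comPzRingType) (x : R) k j :
  2 * (x - j%:R) * (2 * x - 2 * j%:R + 1) * cheb R k.+1 j
  + (x - j%:R + 1) ^+ 2 * (if j is i.+1 then cheb R k.+1 i else 0) =
  (x - k.+1%:R) ^+ 2 * cheb R k.+2 j
  + 2 * (x ^+ 2 + x - k.+1%:R ^+ 2) * cheb R k.+1 j
  + (x + k.+1%:R) ^+ 2 * cheb R k j.
Proof.
have := cheb_second_difference R k j.
move: (if _ is _.+1 then _ else _) => u uE.
have {uE}-> : u = cheb R k.+2 j - 2 * cheb R k.+1 j + cheb R k j.
  by rewrite uE; ring.
rewrite /cheb !addSn /=.
have := bin_predM R (k + j) (2 * j); have := bin_predM R (k + j).+1 (2 * j).
have : (k + j)%:R * 'C((k + j).-1, 2 * j)%:R =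
    ((k + j)%:R - (2 * j)%:R) * 'C((k + j), 2 * j)%:R :> R.
  case: (k + j)%N => [|m]; last exact: bin_predM.
  case: (posnP j) => [->|j0]; first by rewrite muln0 subrr.
  by rewrite !bin_small ?muln_gt0 // !mulr0.
rewrite -[k.+1%:R]natr1 -![_.+2%:R]natr1 -![_.+1%:R]natr1 !natrM !natrD.
move: ('C((k + j).+2, _)%:R) ('C((k + j).+1, _)%:R) ('C((k + j), _)%:R)
  ('C((k + j).-1, _)%:R) (k%:R) (j%:R) => a b c d y z Hd Hc Hb.
apply/eqP; rewrite -subr_eq0; apply/eqP.
(* With [u] eliminated, the difference of the two sides is a combination of the three absorption
   relations with these multipliers. *)
transitivity (- (2 * x - y - z) *
      ((y + z + 1 + 1) * b - (y + z + 1 + 1 - 2 * z) * a)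
  - (4 * x - 2 * z) * ((y + z + 1) * c - (y + z + 1 - 2 * z) * b)
  - (2 * x + y - z + 2) * ((y + z) * d - (y + z - 2 * z) * c)); first by ring.
by rewrite Hb Hc Hd !subrr !mulr0 !subr0.
Qed.

Lemma cheb0 (R : pzRingType) j : cheb R 0 j = if j == 0%N then 2 else 0.
Proof.
by case: j => [|j]; rewrite /cheb /= ?bin0 // !bin_small ?addr0 //; lia.
Qed.

Lemma cheb1 (R : pzRingType) j : 
  cheb R 1 j = if j == 0%N then 2 else if j == 1%N then 1 else 0.
Proof.
case: j => [|[|j]]; rewrite /cheb /= ?bin0 //.
  rewrite (_ : 'C(1 + 1, 2 * 1) = 1%N) //.
  by rewrite (_ : 'C((1 + 1).-1, 2 * 1) = 0%N) ?addr0.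
by rewrite !bin_small ?addr0 //; lia.
Qed.

(** In truncated subtraction [n - l + (l - n)] is |n - l|. On either side of l = n this is the
    contiguity relation at x = n, with the outer terms exchanged; at l = n both neighbours have
    distance 1 and explicit values are compared. *)
Lemma cheb_contiguity_dist (R : comPzRingType) n l j : (l <= 2 * n)%N ->
  2 * (n%:R - j%:R) * (2 * n%:R - 2 * j%:R + 1) * cheb R (n - l + (l - n))%N j
  + (n%:R - j%:R + 1) ^+ 2 *
    (if j is i.+1 then cheb R (n - l + (l - n))%N i else 0) =
  l%:R ^+ 2 * cheb R (n.+1 - l + (l - n.+1))%N j
  + ((l%:R + 1) * (2 * n%:R - l%:R) + (2 * n%:R + 1 - l%:R) * l%:R)
     * cheb R (n - l + (l - n))%N j
  + (2 * n%:R - l%:R) ^+ 2 * cheb R (n.+1 - l.+2 + (l.+2 - n.+1))%N j.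
Proof.
move=> ln; have [nl|nl|<-] := ltngtP n l.
- have [k lE] : exists k, l = (n + k.+1)%N by exists (l - n.+1)%N; lia.
  have -> : (n - l + (l - n))%N = k.+1 by lia.
  have -> : (n.+1 - l + (l - n.+1))%N = k by lia.
  have -> : (n.+1 - l.+2 + (l.+2 - n.+1))%N = k.+2 by lia.
  by rewrite cheb_contiguity lE natrD; ring.
- have [k nE] : exists k, n = (l + k.+1)%N by exists (n - l.+1)%N; lia.
  have -> : (n - l + (l - n))%N = k.+1 by lia.
  have -> : (n.+1 - l + (l - n.+1))%N = k.+2 by lia.
  have -> : (n.+1 - l.+2 + (l.+2 - n.+1))%N = k by lia.
  by rewrite cheb_contiguity nE natrD; ring.
have -> : (n - n + (n - n))%N = 0%N by lia.
have -> : (n.+1 - n + (n - n.+1))%N = 1%N by lia.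
have -> : (n.+1 - n.+2 + (n.+2 - n.+1))%N = 1%N by lia.
by case: j => [|[|j]]; rewrite !cheb0 !cheb1 /=; ring.
Qed.

Lemma circ_eulerian_recR (R : pzRingType) n l : (circ_eulerian n.+2 l.+1)%:R =
  l.+1%:R * (circ_eulerian n.+1 l.+1)%:R
  + (n.+1%:R - l%:R) * (circ_eulerian n.+1 l)%:R :> R.
Proof.
rewrite circ_eulerian_rec mul1n natrD !natrM subSS.
have [ln|nl] := leqP l n.+1; first by rewrite natrB.
by rewrite !circ_eulerian_gt ?mulr0 // ltnW // ltnW.
Qed.

(** Two insertions into an arrangement of 2n labels with l descents lead to l, l + 1 or l + 2
    descents, in as many ways as the three weights say. Grouping by the initial arrangement moves
    the recursion onto the test function [f]. *)
Lemma sum_circ_eulerian_rec (R : comPzRingType) n (f : nat -> R) : (0 < n)%N ->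
  \sum_(l < (2 * n.+1).+1) f l * (circ_eulerian (2 * n.+1) l)%:R =
  \sum_(l < (2 * n).+1)
    (l%:R ^+ 2 * f l
     + ((l%:R + 1) * (2 * n%:R - l%:R) + (2 * n%:R + 1 - l%:R) * l%:R) * f l.+1
     + (2 * n%:R - l%:R) ^+ 2 * f l.+2) * (circ_eulerian (2 * n) l)%:R.
Proof.
case: n => // n _; pose m := (2 * n)%N.
have mE : 2 * n.+1%:R = m.+2%:R :> R by rewrite -natrM; congr _%:R; lia.
rewrite (_ : 2 * n.+2 = m.+4)%N; last by lia.
rewrite (_ : 2 * n.+1 = m.+2)%N; last by lia.
have [M ME] : exists M : R, M = m.+2%:R by exists m.+2%:R.
rewrite mE -ME.
have e0 l : (circ_eulerian l.+2 0)%:R = 0 :> R by rewrite circ_eulerian0.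
have e1 : (circ_eulerian m.+4 1)%:R = (circ_eulerian m.+2 1)%:R :> R.
  by rewrite !circ_eulerian_recR !e0 !mulr0 !addr0 !mul1r.
have e3 : (circ_eulerian m.+2 m.+3)%:R = 0 :> R by rewrite circ_eulerian_gt.
have e4 : (circ_eulerian m.+2 m.+4)%:R = 0 :> R.
  by rewrite circ_eulerian_gt // ltnW.
under [RHS]eq_bigr => l _ do rewrite mulrDl mulrDl.
rewrite !big_split /=.
rewrite (big_ord_recl m.+4) (big_ord_recl m.+3) /= e0 mulr0 add0r e1.
have -> : \sum_(l < m.+3) l%:R ^+ 2 * f l * (circ_eulerian m.+2 l)%:R =
    f 1%N * (circ_eulerian m.+2 1)%:R
    + \sum_(l < m.+3) l.+2%:R ^+ 2 * f l.+2 * (circ_eulerian m.+2 l.+2)%:R.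
  rewrite (big_ord_recl m.+2) (big_ord_recl m.+1) /= e0 mulr0 add0r expr1n mul1r.
  by rewrite (big_ord_recr m.+2) (big_ord_recr m.+1) /= e3 e4 !mulr0 !addr0.
have -> : \sum_(l < m.+3) ((l%:R + 1) * (M - l%:R) + (M + 1 - l%:R) * l%:R)
       * f l.+1 * (circ_eulerian m.+2 l)%:R =
   \sum_(l < m.+3) ((l.+1%:R + 1) * (M - l.+1%:R) + (M + 1 - l.+1%:R) * l.+1%:R)
       * f l.+2 * (circ_eulerian m.+2 l.+1)%:R.
  rewrite (big_ord_recl m.+2) /= e0 mulr0 add0r.
  by rewrite (big_ord_recr m.+2) /= e3 mulr0 addr0.
rewrite -!addrA; congr (_ + _); rewrite -!big_split /=; apply: eq_bigr => l _.
rewrite (circ_eulerian_recR _ m.+2) !(circ_eulerian_recR _ m.+1).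
rewrite -[m.+3%:R]natr1 -ME -[l.+2%:R]natr1 -[l.+1%:R]natr1.
move: (circ_eulerian _ _)%:R (circ_eulerian _ _)%:R (circ_eulerian _ _)%:R => x y z.
by rewrite /bump /= !add1n; move: (l%:R) (f _) => v w; ring.
Qed.

(** For j < n this is 2 a_{n,n-j}, spread over all l from 0 to 2n by the symmetry of the circular
    Eulerian numbers. *)
Definition acoef_sum (R : pzRingType) (n j : nat) : R :=
  (- 4) ^+ j * \sum_(l < (2 * n).+1)
    cheb R (n - l + (l - n)) j * (circ_eulerian (2 * n) l)%:R.

Lemma acoef_sum_rec (R : comPzRingType) n j : (0 < n)%N ->
  acoef_sum R n.+1 j =
  2 * (n%:R - j%:R) * (2 * n%:R - 2 * j%:R + 1) * acoef_sum R n j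
  - 4 * (n%:R - j%:R + 1) ^+ 2 * (if j is i.+1 then acoef_sum R n i else 0).
Proof.
move=> n0; rewrite /acoef_sum.
rewrite (sum_circ_eulerian_rec (fun l => cheb R (n.+1 - l + (l - n.+1)) j)) //.
transitivity ((- 4) ^+ j * \sum_(l < (2 * n).+1)
  (2 * (n%:R - j%:R) * (2 * n%:R - 2 * j%:R + 1) * cheb R (n - l + (l - n))%N j
  + (n%:R - j%:R + 1) ^+ 2 *
    (if j is i.+1 then cheb R (n - l + (l - n))%N i else 0))
   * (circ_eulerian (2 * n) l)%:R : R).
  congr (_ * _); apply: eq_bigr => l _; rewrite cheb_contiguity_dist ?subSS //.
  by rewrite -ltnS.
under eq_bigr => l _ do rewrite mulrDl -!mulrA.
rewrite big_split /= -!big_distrr /=.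
case: j => [|j]; last by rewrite exprS; ring.
rewrite (_ : \sum_(l < (2 * n).+1) 0 * (circ_eulerian (2 * n) l)%:R = 0); last first.
  by rewrite big1 // => l _; rewrite mul0r.
by ring.
Qed.

(** By absorption C(k+j-1, 2j) = (k-j)/(k+j) C(k+j, 2j), so the two binomials of [cheb] add up to
    2k/(k+j) C(k+j, 2j). *)
Lemma tcoef_cheb (R : numFieldType) k j : (0 < k)%N -> (j <= k)%N ->
  2 * (-1) ^+ k *
  ((-1) ^+ (k - j) * 2 ^+ (2 * j) * (k%:R / (k + j)%:R) * 'C(k + j, k - j)%:R)
  = (- 4) ^+ j * cheb R k j.
Proof.
move=> k0 jk; rewrite /cheb.
have := bin_predM R (k + j).-1 (2 * j); rewrite prednK ?addn_gt0 ?k0 // => Hd.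
have kj0 : k%:R + j%:R != 0 :> R by rewrite -natrD pnatr_eq0 -lt0n addn_gt0 k0.
rewrite natrM natrD in Hd *.
rewrite (_ : 'C(k + j, k - j) = 'C(k + j, 2 * j)); last first.
  by rewrite -[RHS]bin_sub; [congr binomial; lia | lia].
have {Hd}-> : 'C((k + j).-1, 2 * j)%:R =
    (k%:R + j%:R - 2 * j%:R) / (k%:R + j%:R) * 'C(k + j, 2 * j)%:R :> R.
  by apply: (mulfI kj0); rewrite Hd; field; exact: kj0.
have -> : (-4) ^+ j = (-1) ^+ k * (-1) ^+ (k - j) * 2 ^+ (2 * j) :> R.
  rewrite -exprD (_ : k + (k - j) = j + 2 * (k - j))%N; last by lia.
  by rewrite exprD !exprM sqrrN expr1n expr1n mulr1 -exprMn; congr (_ ^+ _); ring.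
by field; exact: kj0.
Qed.

(** Folding the full sum along l -> 2n - l doubles the terms below l = n and leaves the middle one
    single. The term l = 0 vanishes, and so do those with i < l, by the degree in the Chebyshev
    coefficients. The middle term occurs only for i = n; its missing factor 2 is what the convention
    t(0,0) = 1/2 accounts for. *)
Lemma acoefE (R : realType) n i : (0 < i <= n)%N ->
  2 * acoef R n i = acoef_sum R n (n - i).
Proof.
case: n => [|n]; first by case: i.
move=> /andP[i0 iN].
pose g l : R := cheb R (n.+1 - l + (l - n.+1)) (n.+1 - i) *
  (circ_eulerian (2 * n.+1) l)%:R.
have g0 : g 0%N = 0 by rewrite /g mulnS /= circ_eulerian0 mulr0.
have gsym l : (l <= n)%N -> g (n.+1 + (n.+1 - l))%N = g l.
  move=> ln; rewrite /g (_ : n.+1 + (n.+1 - l) = 2 * n.+1 - l)%N; last by lia.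
  have -> : circ_eulerian (2 * n.+1) (2 * n.+1 - l) = circ_eulerian (2 * n.+1) l.
    by rewrite (_ : 2 * n.+1 = (2 * n).+2)%N ?circ_eulerian_sym //; lia.
  by congr (cheb _ _ _ * _); lia.
have gL l : (i < l)%N -> (l < n.+1)%N -> g l = 0.
  by move=> il ln; rewrite /g /cheb !bin_small ?addr0 ?mul0r //; lia.
rewrite /acoef_sum -/(g _).
have -> : \sum_(l < (2 * n.+1).+1) g l = 2 * \sum_(l < n.+1) g l + g n.+1.
  rewrite -(big_mkord xpredT) (@big_cat_nat _ _ _ n.+1) //=; last by lia.
  rewrite big_mkord big_ltn; last by lia.
  rewrite -{1}(add0n n.+2) big_addn (_ : (2 * n.+1).+1 - n.+2 = n.+1)%N; last by lia.
  rewrite big_mkord [X in _ + (_ + X) = _](_ : _ = \sum_(l < n.+1) g l); first by ring.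
  rewrite (reindex_inj rev_ord_inj) /=; apply: eq_bigr => l _.
  rewrite -[RHS]gsym ?(ltn_ord l) //; last by rewrite -ltnS.
  by congr g; have := ltn_ord l; lia.
have -> : 2 * \sum_(l < n.+1) g l + g n.+1 =
    \sum_(0 <= l < n.+2) (if l == n.+1 then g l else 2 * g l).
  rewrite big_nat_recr //= eqxx big_mkord big_distrr /=; congr (_ + _).
  by apply: eq_bigr => l _; rewrite ltn_eqF.
rewrite big_ltn // g0 mulr0 add0r /acoef mulrA.
rewrite [in RHS](@big_cat_nat _ _ _ i.+1) //=.
rewrite [X in _ = _ * (_ + X)]big1_seq ?addr0; last first.
  move=> l; rewrite mem_index_iota => /andP[_ /andP[il]]; rewrite ltnS leq_eqVlt.
  case: eqP => [ln _|_ ln]; last by rewrite /= in ln; rewrite gL ?mulr0.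
  rewrite /g ln subnn cheb0; case: eqP => [|_]; last by rewrite mul0r.
  by move: il; rewrite ln; lia.
rewrite !big_distrr /=; apply: eq_big_nat => l /andP[l0]; rewrite ltnS => li.
rewrite /tcoef; have [ln|ln] := eqVneq l n.+1.
  rewrite ln /g (_ : n.+1 - i = 0)%N; last by lia.
  by rewrite !subnn cheb0 !eqxx !expr0; field.
have kl : (0 < n.+1 - l)%N by lia.
rewrite (_ : (n.+1 - l)%N == 0%N = false); last by apply/negbTE; rewrite -lt0n.
rewrite /g (_ : l - n.+1 = 0)%N ?addn0; last by lia.
have := @tcoef_cheb R _ (n.+1 - i) kl.
rewrite (_ : (n.+1 - i <= n.+1 - l)%N); last by lia.
move=> /(_ isT); move: (_ / _) => q H.
rewrite [RHS]mulrCA (mulrA ((-4) ^+ _)) -H; ring.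
Qed.

Lemma acoef_rec (R : realType) n i : (0 < i <= n)%N ->
  acoef R n.+1 i.+1 = 2 * i%:R * (2 * i%:R + 1) * acoef R n i
    - 4 * i.+1%:R ^+ 2 * (if (i < n)%N then acoef R n i.+1 else 0).
Proof.
move=> /andP[i0 iN]; have n0 : (0 < n)%N by lia.
have two0 : 2 != 0 :> R by rewrite pnatr_eq0.
apply: (mulfI two0); rewrite acoefE ?ltnS // subSS acoef_sum_rec //.
rewrite natrB // -acoefE ?i0 //.
case: ltngtP iN => // [iN _|<- _]; last by rewrite subnn; ring.
rewrite -(subnSK iN) -acoefE ?ltnS //.
rewrite -natr1; ring.
Qed.

Lemma acoef_rec1 (R : realType) n : (0 < n)%N ->
  acoef R n.+1 1 = - 4 * acoef R n 1.
Proof.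
move=> n0; have two0 : 2 != 0 :> R by rewrite pnatr_eq0.
apply: (mulfI two0); rewrite acoefE ?ltnS // subSS acoef_sum_rec // subn0 subrr.
case: n n0 => // n _; have := @acoefE R n.+1 1 isT; rewrite subSS subn0 => <-; ring.
Qed.

Lemma acoef11 (R : realType) : acoef R 1 1 = 1.
Proof.
rewrite /acoef big_nat1 /tcoef subnn eqxx !expr0 (circ_eulerian_rec 0).
by rewrite !circ_eulerian1 (_ : 1 * _ + _ = 1)%N //; field.
Qed.

Lemma acoef_lead (R : realType) n : (0 < n)%N -> acoef R n n = ((2 * n).-1)`!%:R.
Proof.
case: n => // n _; elim: n => [|n IHn]; first by rewrite acoef11.
rewrite acoef_rec ?leqnn // ltnn mulr0 subr0 IHn.
rewrite (_ : (2 * n.+2).-1 = (2 * n.+1).-1.+2)%N; last by lia.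
rewrite !factS !natrM -(addn2 (2 * n.+1).-1) natrD; last first.
have -> : (2 * n.+1).-1.+1%:R = 2 * n.+1%:R :> R by rewrite -natrM; congr _%:R; lia.
have -> : (2 * n.+1).-1%:R = 2 * n.+1%:R - 1 :> R.
  by rewrite -natrM -subn1 natrB //; lia.
ring.
Qed.

(** * The duplication formula *)

(* The operator taking p to q when (p(csc^2 x))'' = q(csc^2 x). *)
Definition csc2_deriv2 (R : nzRingType) (p : {poly R}) : {poly R} :=
  4 * 'X ^+ 2 * ('X - 1) * p^`()^`() + (6 * 'X ^+ 2 - 4 * 'X) * p^`().

Lemma csc2_deriv2_sum (R : comNzRingType) (r : seq nat) (c : nat -> R)
    (p : nat -> {poly R}) :
  csc2_deriv2 (\sum_(i <- r) c i *: p i) = \sum_(i <- r) c i *: csc2_deriv2 (p i).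
Proof.
have dZ (a : R) (q : {poly R}) : csc2_deriv2 (a *: q) = a *: csc2_deriv2 q.
  by rewrite /csc2_deriv2 !derivZ scalerDr -!scalerAr.
have dD : {morph @csc2_deriv2 R : q q' / q + q'}.
  by move=> q q'; rewrite /csc2_deriv2 !derivD; ring.
have d0 : csc2_deriv2 0 = 0 :> {poly R}.
  by rewrite /csc2_deriv2 !deriv0 !mulr0 addr0.
by rewrite (big_morph _ dD d0); apply: eq_bigr => i _; rewrite dZ.
Qed.

Lemma csc2_deriv2Xn (R : comNzRingType) i : (0 < i)%N ->
  csc2_deriv2 ('X ^+ i : {poly R}) =
  (2 * i%:R * (2 * i%:R + 1)) *: 'X ^+ i.+1 - (4 * i%:R ^+ 2) *: 'X ^+ i.
Proof.
have dX k : ('X ^+ k.+1 : {poly R})^`() = k.+1%:R * 'X ^+ k.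
  by rewrite derivXn mulr_natl.
have d k : (k%:R : {poly R})^`() = 0 by rewrite -polyC_natr derivC.
case: i => // i _; rewrite /csc2_deriv2 dX derivM d mul0r add0r -!mul_polyC.
rewrite !(polyCB, polyCM, polyCD, polyC_exp, polyC_natr, polyC1).
case: i => [|i]; first by rewrite expr0 -polyC1 derivC polyC1; ring.
by rewrite dX !exprS -[i.+2%:R]natr1; move: (i.+1%:R) => k; ring.
Qed.

(* power_sum i is u^i + v^i as a polynomial in w, where u + v = u v = 4 w, as
   for u = csc^2 x, v = csc^2 (x + pi/2) and w = csc^2 (2 x). *)
Fixpoint power_sum (R : nzRingType) (i : nat) : {poly R} :=
  match i with
  | 0 => 2
  | 1 => 4 * 'X
  | (j.+1 as k).+1 => 4 * 'X * (power_sum R k - power_sum R j)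
  end.

Lemma power_sumSS (R : nzRingType) i :
  power_sum R i.+2 = 4 * 'X * (power_sum R i.+1 - power_sum R i).
Proof. by []. Qed.

Lemma horner_power_sum (R : fieldType) (u v : R) i : 4 != 0 :> R ->
  u + v = u * v -> (power_sum R i).[u * v / 4] = u ^+ i + v ^+ i.
Proof.
move=> n4 uv; have c k : (k%:R : {poly R}).[u * v / 4] = k%:R.
  by rewrite -polyC_natr hornerC.
have m4 : 4 * (u * v / 4) = u * v by field; exact: n4.
have [//] : (power_sum R i).[u * v / 4] = u ^+ i + v ^+ i /\
  (power_sum R i.+1).[u * v / 4] = u ^+ i.+1 + v ^+ i.+1.
elim: i => [|i [IH1 IH2]].
  by rewrite /= hornerM !c hornerX m4 !expr0 !expr1 uv.
split=> //; rewrite power_sumSS !hornerM hornerX c m4 hornerD hornerN IH1 IH2.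
apply/eqP; rewrite -subr_eq0; apply/eqP.
transitivity (- (u ^+ i.+1 + v ^+ i.+1) * (u + v - u * v)).
  by rewrite !exprS; ring.
by rewrite uv subrr mulr0.
Qed.

(** Formally, the roots u, v of t^2 - 4wt + 4w satisfy 4w(w-1) u' = u^2 - 2u, whence 4w(w-1) (u^i)'
    = i (u^{i+1} - 2u^i), and likewise for v. *)
Lemma deriv_power_sum (R : comNzRingType) i :
  4 * 'X * ('X - 1) * (power_sum R i)^`() =
  i%:R * (power_sum R i.+1 - 2 * power_sum R i).
Proof.
have d k : (k%:R : {poly R})^`() = 0 by rewrite -polyC_natr derivC.
have [//] : 4 * 'X * ('X - 1) * (power_sum R i)^`() =
    i%:R * (power_sum R i.+1 - 2 * power_sum R i) /\
  4 * 'X * ('X - 1) * (power_sum R i.+1)^`() =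
    i.+1%:R * (power_sum R i.+2 - 2 * power_sum R i.+1).
elim: i => [|i [IH1 IH2]].
  by split; rewrite ?power_sumSS /= ?derivM !d ?derivX; ring.
split=> //; rewrite !power_sumSS derivM derivM d derivX derivB.
move: IH1 IH2; rewrite !power_sumSS -[i.+1%:R]natr1 -[i.+2%:R]natr1.
move: (power_sum R i.+1) (power_sum R i) => S1 S0.
move: (S1^`()) (S0^`()) => p1 p0 H0 H1.
transitivity (4 * 'X * (4 * 'X * ('X - 1) * p1 - 4 * 'X * ('X - 1) * p0)
   + 16 * 'X * ('X - 1) * (S1 - S0)); first by ring.
by rewrite H0 H1 -natr1; ring.
Qed.

(** Differentiating csc^{2i} x + csc^{2i} (x + pi/2) twice in x gives the right-hand side; as a
    function of csc^2 (2x) it produces the factor 4 by the chain rule. *)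
Lemma csc2_deriv2_power_sum (R : numDomainType) i :
  4 * csc2_deriv2 (power_sum R i) =
  (2 * i%:R * (2 * i%:R + 1)) * power_sum R i.+1 - (4 * i%:R ^+ 2) * power_sum R i.
Proof.
have H1 := deriv_power_sum R i; have H2 := deriv_power_sum R i.+1.
have H3 := congr1 (@deriv R) H1.
have d k : (k%:R : {poly R})^`() = 0 by rewrite -polyC_natr derivC.
have d1 : (1 : {poly R})^`() = 0 by rewrite -polyC1 derivC.
rewrite !(derivM, derivB, derivX, d, d1) in H3.
(* The relations for the derivatives carry a factor X - 1, so the identity is proved after
   multiplication by 4 (X - 1). *)
have cancel4 : 4 * ('X - 1) != 0 :> {poly R}.
  by rewrite mulf_neq0 ?polyXsubC_eq0 // -polyC_natr polyC_eq0 pnatr_eq0.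
apply: (mulfI cancel4).
rewrite /csc2_deriv2; move: H1 H2 H3; rewrite power_sumSS -[i.+1%:R]natr1.
move: (power_sum R i.+1) (power_sum R i) => S1 S0.
move: (i%:R) (S0^`()) (S1^`()) (S0^`()^`()) => k p q r H1 H2 H3.
apply/eqP; rewrite -subr_eq0; apply/eqP.
transitivity (16 * 'X * ('X - 1) *
    (((0 * 'X + 4 * 1) * ('X - 1) + 4 * 'X * (1 - 0)) * p
      + 4 * 'X * ('X - 1) * r - (0 * (S1 - 2 * S0) + k * (q - (0 * S0 + 2 * p))))
  + 4 * k * (4 * 'X * ('X - 1) * q - (k + 1) * (4 * 'X * (S1 - S0) - 2 * S1))
  - 8 * (k + 'X) * (4 * 'X * ('X - 1) * p - k * (S1 - 2 * S0))); first by ring.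
by rewrite H1 H2 H3 !subrr !mulr0 subr0 addr0.
Qed.

(** The recursion of the coefficients, transposed. The family [T] is arbitrary because two bases are
    needed: the powers of X and the power sums. *)
Lemma sum_acoef_rec (R : realType) (V : lmodType R) (T : nat -> V) n : (0 < n)%N ->
  \sum_(1 <= i < n.+2) acoef R n.+1 i *: T i =
  \sum_(1 <= i < n.+1) acoef R n i *:
    ((2 * i%:R * (2 * i%:R + 1)) *: T i.+1 - (4 * i%:R ^+ 2) *: T i).
Proof.
case: n => // n _.
pose f i := (acoef R n.+1 i * (2 * i%:R * (2 * i%:R + 1))) *: T i.+1.
pose g i := (acoef R n.+1 i * (4 * i%:R ^+ 2)) *: T i.
transitivity (\sum_(1 <= i < n.+2) f i - \sum_(1 <= i < n.+2) g i); last first.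
  by rewrite -sumrB; apply: eq_bigr => i _; rewrite scalerBr !scalerA.
have -> : \sum_(1 <= i < n.+2) g i =
    g 1%N + \sum_(1 <= i < n.+2) (if (i < n.+1)%N then g i.+1 else 0).
  rewrite big_ltn // big_add1 [in RHS]big_nat_recr //= ltnn addr0.
  by congr (_ + _); apply: eq_big_nat => i /andP[_ ->].
rewrite opprD addrCA -sumrB big_ltn // big_add1 /=; congr (_ + _).
  by rewrite acoef_rec1 // /g -scaleNr; congr (_ *: _); ring.
apply: eq_big_nat => i iN; rewrite acoef_rec // scalerBl; congr (_ - _).
  by congr (_ *: _); rewrite mulrC.
case: ifP => _; last by rewrite mulr0 scale0r.
by rewrite /g mulrC.
Qed.

Definition csc2_poly (R : realType) n : {poly R} :=
  \sum_(1 <= i < n.+1) acoef R n i *: 'X ^+ i.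

Lemma csc2_poly_rec (R : realType) n : (0 < n)%N ->
  csc2_poly R n.+1 = csc2_deriv2 (csc2_poly R n).
Proof.
move=> n0; rewrite /csc2_poly (sum_acoef_rec (fun i => 'X ^+ i)) //.
rewrite csc2_deriv2_sum; apply: eq_big_nat => i /andP[i0 _].
by rewrite csc2_deriv2Xn.
Qed.

(** Both sides get the operator applied when n grows: on the power sums the recursion amounts to 4
    times the operator, on [csc2_poly] to the operator itself. Hence the factor 4 per step. *)
Lemma sum_acoef_power_sum (R : realType) n : (0 < n)%N ->
  \sum_(1 <= i < n.+1) acoef R n i *: power_sum R i = 4 ^+ n *: csc2_poly R n.
Proof.
case: n => // n _; elim: n => [|n IHn].
  by rewrite /csc2_poly !big_nat1 acoef11 !scale1r !expr1 -mul_polyC polyC_natr.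
rewrite csc2_poly_rec // exprS -scalerA.
have -> : 4 ^+ n.+1 *: csc2_deriv2 (csc2_poly R n.+1) =
    csc2_deriv2 (4 ^+ n.+1 *: csc2_poly R n.+1).
  have := @csc2_deriv2_sum R [:: 0%N] (fun=> 4 ^+ n.+1) (fun=> csc2_poly R n.+1).
  by rewrite !big_seq1.
rewrite -IHn csc2_deriv2_sum sum_acoef_rec // scaler_sumr.
apply: eq_bigr => i _; rewrite [RHS]scalerA [in RHS]mulrC -[RHS]scalerA; congr (_ *: _).
rewrite -mul_polyC polyC_natr csc2_deriv2_power_sum -!mul_polyC.
by rewrite !(polyCM, polyCD, polyC_exp, polyC_natr, polyC1).
Qed.

Lemma acoef_doubling (R : realType) n (u v : R) : (0 < n)%N -> u + v = u * v ->
  \sum_(1 <= i < n.+1) acoef R n i * u ^+ i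
  + \sum_(1 <= i < n.+1) acoef R n i * v ^+ i =
  4 ^+ n * \sum_(1 <= i < n.+1) acoef R n i * (u * v / 4) ^+ i.
Proof.
move=> n0 uv; have n4 : 4 != 0 :> R by rewrite pnatr_eq0.
rewrite -big_split /=.
have := congr1 (fun p => p.[u * v / 4]) (sum_acoef_power_sum R n0).
rewrite hornerZ !horner_sum.
rewrite [X in _ = _ * X -> _](_ : _ =
  \sum_(1 <= i < n.+1) acoef R n i * (u * v / 4) ^+ i); last first.
  by apply: eq_bigr => i _; rewrite hornerZ hornerXn.
move=> <-; apply: eq_bigr => i _.
by rewrite hornerZ horner_power_sum // mulrDr.
Qed.

(** * Zeta values as limits of cosecant sums *)

Section Analysis.
Local Open Scope classical_set_scope.

Lemma sin_le_id (R : realType) (x : R) : 0 <= x -> sin x <= x.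
Proof.
move=> x0; pose f (t : R) := t - sin t.
have df (t : R) : is_derive t 1 f (1 - cos t) by apply: is_deriveB.
have cf : {within `[0, x], continuous f}.
  by apply: continuous_subspaceT => t; apply: cvgB => //; exact: continuous_sin.
have [c _] := MVT_segment x0 (fun t _ => df t) cf.
rewrite /f sin0 !subr0 => E.
by rewrite -subr_ge0 E mulr_ge0 // subr_ge0 cos_le1.
Qed.

Lemma mul_cos_le_sin (R : realType) (x : R) : 0 <= x <= pi -> x * cos x <= sin x.
Proof.
move=> /andP[x0 xpi]; pose f (t : R) := sin t - t * cos t.
have df (t : R) : is_derive t 1 f (t * sin t).
  by apply: trigger_derive; rewrite /GRing.scale /=; ring.
have cf : {within `[0, x], continuous f}.
  apply: continuous_subspaceT => t; apply: cvgB; first exact: continuous_sin.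
  by apply: cvgM => //; exact: continuous_cos.
have [c] := MVT_segment x0 (fun t _ => df t) cf.
rewrite in_itv /= => /andP[c0 cx].
rewrite /f sin0 mul0r !subr0 => E; rewrite -subr_ge0 E !mulr_ge0 //.
by rewrite sin_ge0_pi // c0 (le_trans cx).
Qed.

Lemma csc2_ge (R : realType) (x : R) : 0 < x < pi -> x ^- 2 <= sin x ^- 2.
Proof.
move=> /andP[x0 xpi]; have s0 : 0 < sin x by rewrite sin_gt0_pi ?x0.
rewrite lef_pV2 ?posrE ?exprn_gt0 // lerXn2r ?nnegrE ?(ltW x0) ?(ltW s0) //.
by rewrite sin_le_id ?ltW.
Qed.

(** Squaring x cos x <= sin x gives x^2 (1 - sin^2 x) <= sin^2 x, which is divided by x^2 sin^2
    x. *)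
Lemma csc2_le (R : realType) (x : R) : 0 < x <= pi / 2 -> sin x ^- 2 <= x ^- 2 + 1.
Proof.
move=> /andP[x0 xpi]; have pi0 := pi_gt0 R.
have s0 : 0 < sin x by rewrite sin_gt0_pi // x0 /=; lra.
have c0 : 0 <= cos x by rewrite cos_ge0_pihalf // xpi andbT; lra.
have : (x * cos x) ^+ 2 <= sin x ^+ 2.
  rewrite lerXn2r ?nnegrE ?mulr_ge0 ?(ltW x0) ?(ltW s0) //.
  by rewrite mul_cos_le_sin // ltW //=; lra.
rewrite exprMn cos2sin2 => H.
rewrite -[leRHS](mulfK (lt0r_neq0 (exprn_gt0 2 s0))).
rewrite -[leLHS]mul1r ler_pM2r ?invr_gt0 ?exprn_gt0 //.
rewrite mulrDl mul1r -lerBlDr mulrC ler_pdivlMr ?exprn_gt0 //; lra.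
Qed.

(** For y >= 1/4 one has t <= y + 1 <= 5y, so the i-th power changes only by the order of y^{i-1}.
    The threshold is x^-2 at x = 2, beyond pi/2. *)
Lemma near_expr_bounds (R : realFieldType) (y t : R) i :
  y <= t <= y + 1 -> 1 <= 4 * y ->
  y ^+ i <= t ^+ i <= y ^+ i + i%:R * 5 ^+ i * y ^+ i.-1.
Proof.
move=> /andP[yt ty] y4; have y0 : 0 <= y by lra.
rewrite lerXn2r ?nnegrE ?(le_trans y0 yt) //=.
elim: i => [|i IHi]; first by rewrite !mul0r addr0.
have t0 := le_trans y0 yt.
rewrite exprS (le_trans (ler_pM t0 (exprn_ge0 i t0) ty IHi)) //.
case: i {IHi} => [|i]; first by rewrite mul0r mul0r !expr0 expr1 expr1; lra.
rewrite !exprS -[i.+2%:R]natr1.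
move: (exprn_ge0 i y0) (i.+1%:R) (ler0n R i.+1) => Y0 k k0.
have F1 : 1 <= 5 ^+ i :> R by rewrite exprn_ege1 //; lra.
move: (y ^+ i) (5 ^+ i) Y0 F1 => Y F Y0 F1.
rewrite -subr_ge0.
have -> : y * (y * Y) + (k + 1) * (5 * (5 * F)) * (y * Y)
  - (y + 1) * (y * Y + k * (5 * F) * Y) =
  5 * k * F * Y * (4 * y - 1) + (25 * F - 1) * (y * Y) by ring.
by rewrite addr_ge0 // !mulr_ge0 //; lra.
Qed.

(** [limn] is informative only once convergence is known; the partial sums are bounded by the
    telescoping series of 1/(k(k+1)). *)
Lemma cvg_zeta (R : realType) n : (0 < n)%N ->
  series (fun k => k.+1%:R ^- (2 * n) : R) @ \oo --> zeta ((2 * n)%:R : R).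
Proof.
move=> n0; rewrite /zeta.
have -> : (fun k => (k.+1%:R `^ (2 * n)%:R)^-1 : R) = fun k => k.+1%:R ^- (2 * n).
  by apply/funext => k; rewrite powR_mulrn.
apply: nondecreasing_is_cvgn.
  by apply: nondecreasing_series => k _ _; rewrite invr_ge0 exprn_ge0.
have H k : series (fun k => k.+1%:R ^- (2 * n) : R) k.+1 <= 2 - k.+1%:R^-1.
  elim: k => [|k IHk]; first by rewrite /series /= big_nat1 expr1n invr1; lra.
  rewrite seriesSr (le_trans (lerD IHk (lexx _))) //.
  have k1 : 0 < k.+1%:R :> R by [].
  have k2 : 0 < k.+2%:R :> R by [].
  have H : k.+2%:R ^- (2 * n) <= (k.+1%:R * k.+2%:R)^-1 :> R.
    rewrite lef_pV2 ?posrE ?exprn_gt0 ?mulr_gt0 // (@le_trans _ _ (k.+2%:R ^+ 2)) //.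
      by rewrite expr2 ler_pM2r // ler_nat.
    by rewrite ler_weXn2l // ?ler1n //; lia.
  apply: (le_trans (lerD (lexx _) H)); rewrite -addrA lerD2l -subr_ge0.
  rewrite (_ : - _ - _ = 0) //; rewrite -[k.+2%:R]natr1 in k2 *.
  by field; rewrite !lt0r_neq0.
exists 2 => _ [[|k] _ <-]; first by rewrite /series /= big_geq.
by rewrite (le_trans (H k)) // lerBlDr lerDl invr_ge0.
Qed.

Definition cycle_sum (R : realType) (n N : nat) : R :=
  \sum_(1 <= m < N) sin (m%:R * pi / N%:R) ^- (2 * n).

Lemma sin_cycle_gt0 (R : realType) m N : (0 < m < N)%N ->
  0 < sin (m%:R * pi / N%:R : R).
Proof.
move=> /andP[m0 mN]; have N0 : 0 < N%:R :> R by rewrite ltr0n (leq_trans _ mN).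
have pi0 := pi_gt0 R.
apply: sin_gt0_pi; apply/andP; split; first by rewrite divr_gt0 // mulr_gt0 // ltr0n.
by rewrite ltr_pdivrMr // mulrC ltr_pM2l ?ltr_nat.
Qed.

Lemma cycle_zetaE (R : realType) n N : cycle_zeta N (n%:R : R) = cycle_sum R n N.
Proof.
apply: eq_big_nat => m mN.
by rewrite -natrM powR_mulrn // ltW // sin_cycle_gt0.
Qed.

(** The reflection x -> pi - x leaves only angles below pi/2, where csc^2 x <= x^-2 + 1 is
    available; the middle angle pi/2 contributes 1. For this reason the limit is taken along even
    N. *)
Lemma cycle_sum_double (R : realType) n k :
  cycle_sum R n (2 * k.+1) =
  1 + 2 * \sum_(1 <= m < k.+1) sin (m%:R * pi / (2 * k.+1)%:R) ^- (2 * n).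
Proof.
pose f m : R := sin (m%:R * pi / (2 * k.+1)%:R) ^- (2 * n).
have k0 : k.+1%:R != 0 :> R by rewrite pnatr_eq0.
have fk : f k.+1 = 1.
  rewrite /f natrM (_ : _ / _ = pi / 2); last by field.
  by rewrite sin_pihalf expr1n invr1.
rewrite /cycle_sum (@big_cat_nat _ _ _ k.+1) //=; last by lia.
rewrite [X in _ + X]big_ltn; last by lia.
rewrite -/(f k.+1) fk addrCA mulr_natl mulr2n; congr (_ + (_ + _)).
rewrite (_ : (2 * k.+1)%N = (k.+1 + k.+1)%N); last by lia.
rewrite -{1}(add1n k.+1) big_addn addnK big_nat_rev /=.
apply: eq_big_nat => m /andP[m0 mk].
rewrite (_ : _ * pi / _ = pi - m%:R * pi / (k.+1 + k.+1)%:R).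
  by rewrite sinB sinpi cospi mul0r mulN1r sub0r opprK.
rewrite (_ : (_ - _ + _)%N = (k.+1 + k.+1 - m)%N); last by lia.
rewrite natrB; last by lia.
by field; apply: lt0r_neq0; have := ler0n R k; lra.
Qed.

Lemma cvg_cycle_sum (R : realType) n : (0 < n)%N ->
  cycle_sum R n (2 * k.+1) / (2 * k.+1)%:R ^+ (2 * n) @[k --> \oo]
    --> 2 / pi ^+ (2 * n) * zeta ((2 * n)%:R : R).
Proof.
move=> n0; have pi0 := pi_gt0 R; have pi2 := pi_ge2 R.
pose lb k : R := 2 / pi ^+ (2 * n) * series (fun k => k.+1%:R ^- (2 * n)) k.
(* Each of the k angles costs at most n 5^n (2(k+1))^{2n-2}, since x^-2 <= (2(k+1))^2. Divided by
   (2(k+1))^{2n}, these errors and the middle term 1 are of order 1/(k+1), and [c] is a generous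
   constant for them. *)
pose c : R := 2 * (n%:R * 5 ^+ n) + 1.
have cvg_lb : lb @ \oo --> 2 / pi ^+ (2 * n) * zeta ((2 * n)%:R : R).
  by apply: cvgMr; exact: cvg_zeta.
apply: (@squeeze_cvgr _ _ _ _ lb (fun k => lb k + c * harmonic k)) => //; last first.
  rewrite -[X in _ --> X]addr0 -(mulr0 c); apply: cvgD => //.
  by apply: cvgMr; exact: cvg_harmonic.
apply: nearW => k.
have K0 : 0 < (2 * k.+1)%:R :> R by rewrite ltr0n.
pose x m : R := m%:R * pi / (2 * k.+1)%:R.
have xP m : (0 < m < k.+1)%N -> 0 < x m <= pi / 2.
  move=> /andP[m0 mk]; have m1 : m%:R <= k.+1%:R :> R by rewrite ler_nat ltnW.
  rewrite divr_gt0 ?mulr_gt0 ?ltr0n //= /x ler_pdivrMr // natrM.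
  by rewrite (_ : pi / 2 * _ = k.+1%:R * pi) ?ler_pM2r //; field.
have xE m : (0 < m)%N -> x m ^- (2 * n) / (2 * k.+1)%:R ^+ (2 * n) =
    (pi ^+ (2 * n))^-1 * m%:R ^- (2 * n).
  move=> m0; rewrite /x expr_div_n exprMn; field.
  by rewrite !expf_neq0 ?pnatr_eq0 -?lt0n ?lt0r_neq0.
have lbE : lb k = (2 * \sum_(1 <= m < k.+1) x m ^- (2 * n)) / (2 * k.+1)%:R ^+ (2 * n).
  rewrite /lb /series /= -!mulrA mulr_suml !mulr_sumr [in RHS]big_add1.
  by apply: eq_bigr => m _; rewrite xE.
rewrite lbE cycle_sum_double.
have csc_bounds m : (0 < m < k.+1)%N ->
    x m ^- (2 * n) <= sin (x m) ^- (2 * n) <=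
    x m ^- (2 * n) + n%:R * 5 ^+ n * (2 * k.+1)%:R ^+ (2 * n.-1).
  move=> mk; have /andP[x0 x2] := xP m mk.
  have x2' : x m < 2 by rewrite (le_lt_trans x2) // pihalf_lt2.
  have y4 : 1 <= 4 * x m ^- 2.
    rewrite ler_pdivlMr ?exprn_gt0 // mul1r (_ : 4 = 2 ^+ 2); last by rewrite -natrX.
    by rewrite lerXn2r ?nnegrE // ltW.
  have yt : x m ^- 2 <= sin (x m) ^- 2 <= x m ^- 2 + 1.
    by rewrite csc2_ge ?csc2_le ?x0 //=; lra.
  have /andP[b1 b2] := near_expr_bounds n yt y4.
  rewrite !exprVn -!exprM in b1 b2; rewrite b1 (le_trans b2) // lerD2l.
  rewrite ler_wpM2l ?mulr_ge0 ?ler0n ?exprn_ge0 // -exprVn.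
  rewrite lerXn2r ?nnegrE ?invr_ge0 ?(ltW x0) //.
  rewrite -[leRHS]invrK lef_pV2 ?posrE ?invr_gt0 // /x.
  rewrite -[leLHS]mul1r ler_pM2r ?invr_gt0 //.
  have m1 : 1 <= m%:R :> R by rewrite ler1n; case/andP: mk.
  by rewrite -[leLHS]mul1r ler_pM //; lra.
apply/andP; split.
  rewrite ler_pM2r ?invr_gt0 ?exprn_gt0 // -[leLHS]add0r.
  rewrite lerD // ler_pM2l //; apply: ler_sum_nat => m mk.
  by have /andP[] := csc_bounds m mk.
pose e : R := n%:R * 5 ^+ n * (2 * k.+1)%:R ^+ (2 * n.-1).
have H : \sum_(1 <= m < k.+1) sin (x m) ^- (2 * n) <=
    \sum_(1 <= m < k.+1) x m ^- (2 * n) + k%:R * e.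
  apply: (@le_trans _ _ (\sum_(1 <= m < k.+1) (x m ^- (2 * n) + e))).
    by apply: ler_sum_nat => m mk; have /andP[] := csc_bounds m mk.
  by rewrite big_split /= sumr_const_nat subn1 /= [in leRHS]mulr_natl.
apply: (@le_trans _ _
  ((1 + 2 * (\sum_(1 <= m < k.+1) x m ^- (2 * n) + k%:R * e)) /
   (2 * k.+1)%:R ^+ (2 * n))).
  by rewrite ler_pM2r ?invr_gt0 ?exprn_gt0 // lerD2l ler_pM2l.
rewrite mulrDr addrCA mulrDl lerD2l ler_pdivrMr ?exprn_gt0 // /harmonic /=.
rewrite /e.
have -> : (2 * k.+1)%:R ^+ (2 * n) =
    (2 * k.+1)%:R ^+ 2 * (2 * k.+1)%:R ^+ (2 * n.-1) :> R.
  by rewrite -exprD; congr (_ ^+ _); lia.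
have K1 : 1 <= (2 * k.+1)%:R :> R by rewrite ler1n.
have : 1 <= (2 * k.+1)%:R ^+ (2 * n.-1) :> R by rewrite exprn_ege1.
move: (_ ^+ (2 * n.-1)) => P P1.
rewrite /c natrM -[k.+1%:R]natr1; have := ler0n R k.
have : 0 <= n%:R * 5 ^+ n :> R by rewrite mulr_ge0 ?exprn_ge0.
move: (n%:R * _) (k%:R) => C q C0 q0.
have q1 : q + 1 != 0 by rewrite lt0r_neq0 //; lra.
rewrite (_ : _ / _ * _ = (2 * C + 1) * (4 * (q + 1)) * P); last by field.
rewrite -subr_ge0.
rewrite (_ : _ - _ =
  6 * (q * C * P) + 8 * (C * P) + 4 * (q * P) + 3 * P + (P - 1)); last by ring.
have P0 : 0 <= P by lra.
have CP : 0 <= C * P by rewrite mulr_ge0.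
have qP : 0 <= q * P by rewrite mulr_ge0.
have qCP : 0 <= q * C * P by rewrite -mulrA mulr_ge0.
lra.
Qed.

Definition csc_comb (R : realType) n (x : R) : R :=
  \sum_(1 <= i < n.+1) acoef R n i * (sin x ^- 2) ^+ i.

(** Here u = csc^2 x and v = sec^2 x; their sum equals their product because cos^2 x + sin^2 x = 1,
    and uv/4 = csc^2 (2x). *)
Lemma csc_comb_doubling (R : realType) n (x : R) : (0 < n)%N ->
  sin x != 0 -> cos x != 0 ->
  csc_comb n x + csc_comb n (x + pi / 2) = 4 ^+ n * csc_comb n (2 * x).
Proof.
move=> n0 s0 c0; rewrite /csc_comb sinDpihalf acoef_doubling //; last first.
  transitivity ((cos x ^+ 2 + sin x ^+ 2) / (sin x ^+ 2 * cos x ^+ 2)).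
    by field; rewrite s0 c0.
  by rewrite cos2Dsin2 div1r invfM.
congr (_ * _); apply: eq_bigr => i _; congr (_ * _ ^+ _).
rewrite mulr_natl sin_mulr2n -mulr_natl; field; rewrite s0 c0 //.
Qed.

Definition csc_comb_sum (R : realType) n N : R :=
  \sum_(1 <= m < N) csc_comb n (m%:R * pi / N%:R).

Lemma csc_comb_sumE (R : realType) n N :
  csc_comb_sum R n N = \sum_(1 <= i < n.+1) acoef R n i * cycle_sum R i N.
Proof.
rewrite /csc_comb_sum /csc_comb exchange_big /=; apply: eq_bigr => i _.
by rewrite /cycle_sum mulr_sumr; apply: eq_bigr => m _; rewrite exprVn -exprM.
Qed.

(** The index m = N contributes f_n(pi/2), the only term of the sum for 2, and the angles of m and m
    + N differ by pi/2. *)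
Lemma csc_comb_sum_double (R : realType) n N : (0 < n)%N -> (0 < N)%N ->
  csc_comb_sum R n (2 * N) = csc_comb_sum R n 2 + 4 ^+ n * csc_comb_sum R n N.
Proof.
move=> n0; case: N => // N _; have N0 : N.+1%:R != 0 :> R by rewrite pnatr_eq0.
rewrite {1}/csc_comb_sum (@big_cat_nat _ _ _ N.+1) //=; last by lia.
rewrite [X in _ + X]big_ltn; last by lia.
rewrite addrCA; congr (_ + _).
  rewrite /csc_comb_sum big_nat1; congr csc_comb; rewrite natrM; field.
  by have := ler0n R N => ?; apply: lt0r_neq0; lra.
rewrite -{1}(add1n N.+1) big_addn (_ : 2 * N.+1 - N.+1 = N.+1)%N; last by lia.
rewrite -big_split /= /csc_comb_sum mulr_sumr; apply: eq_big_nat => m mN.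
set x := m%:R * pi / (2 * N.+1)%:R.
have -> : (m + N.+1)%:R * pi / (2 * N.+1)%:R = x + pi / 2.
  by rewrite /x natrD natrM; field.
have xE : m%:R * pi / N.+1%:R = 2 * x.
  by rewrite /x natrM; field.
rewrite csc_comb_doubling // -?xE //.
  by rewrite lt0r_neq0 // sin_cycle_gt0 //; lia.
have := @sin_cycle_gt0 R m N.+1 mN; rewrite xE mulr_natl sin_mulr2n.
by apply: contraTneq => ->; rewrite mul0r mul0rn ltxx.
Qed.

Lemma cvg_invr_exp (R : realType) p : (0 < p)%N ->
  (2 * k.+1)%:R^-1 ^+ p @[k --> \oo] --> (0 : R).
Proof.
move=> p0; have cvgV : (2 * k.+1)%:R^-1 @[k --> \oo] --> (0 : R).
  rewrite -[X in _ --> X](mulr0 2^-1) (_ : (fun _ => _) = fun k => 2^-1 * harmonic k).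
    by apply: cvgMr; exact: cvg_harmonic.
  by apply/funext => k; rewrite /harmonic /= natrM invfM.
have := cvg_comp _ _ cvgV (@exprn_continuous R p 0).
by rewrite expr0n eqn0Ngt p0.
Qed.

(** The cosecant sum with exponent 2i grows like N^{2i}, so division by N^{2n} leaves only i = n. *)
Lemma cvg_csc_comb_sum (R : realType) n : (0 < n)%N ->
  csc_comb_sum R n (2 * k.+1) / (2 * k.+1)%:R ^+ (2 * n) @[k --> \oo]
    --> acoef R n n * (2 / pi ^+ (2 * n) * zeta ((2 * n)%:R : R)).
Proof.
case: n => // n _.
rewrite -[X in _ --> X]add0r.
rewrite (_ : (fun _ => _) = fun k =>
   \sum_(1 <= i < n.+1) acoef R n.+1 i *
      (cycle_sum R i (2 * k.+1) / (2 * k.+1)%:R ^+ (2 * i) *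
       (2 * k.+1)%:R^-1 ^+ (2 * (n.+1 - i)))
  + acoef R n.+1 n.+1 *
    (cycle_sum R n.+1 (2 * k.+1) / (2 * k.+1)%:R ^+ (2 * n.+1))).
  apply: cvgD; last by apply: cvgMr; exact: cvg_cycle_sum.
  (* The range is repeated as a filter so that [cvg_big] provides 0 < i for each summand. *)
  rewrite (_ : (fun _ => _) = fun k => \sum_(1 <= i < n.+1 | (1 <= i < n.+1)%N)
      acoef R n.+1 i * (cycle_sum R i (2 * k.+1) / (2 * k.+1)%:R ^+ (2 * i) *
        (2 * k.+1)%:R^-1 ^+ (2 * (n.+1 - i)))); last first.
    by apply/funext => k; rewrite big_nat.
  rewrite [X in _ --> X](_ : 0 = \sum_(1 <= i < n.+1 | (1 <= i < n.+1)%N) 0); last first.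
    by rewrite big1.
  apply: cvg_big => [|i /andP[i0 iN]]; first exact: add_continuous.
  rewrite -[X in _ --> X](mulr0 (acoef R n.+1 i)); apply: cvgMr.
  rewrite -[X in _ --> X](mulr0 (2 / pi ^+ (2 * i) * zeta ((2 * i)%:R : R))).
  apply: cvgM; first exact: cvg_cycle_sum.
  by apply: cvg_invr_exp; lia.
apply/funext => k; rewrite csc_comb_sumE big_nat_recr //= mulrDl mulr_suml mulrA.
congr (_ + _); apply: eq_big_nat => i iN; rewrite -!mulrA; congr (_ * (_ * _)).
rewrite exprVn -invfM -exprD.
by rewrite (_ : 2 * i + 2 * (n.+1 - i) = 2 * n.+1)%N //; lia.
Qed.

Lemma csc_comb_sum_zeta (R : realType) n N : (0 < n)%N -> (0 < N)%N ->
  csc_comb_sum R n N =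
  (2 * n).-1`!%:R * (2 / pi ^+ (2 * n)) * (N%:R ^+ (2 * n) - 1) *
  zeta ((2 * n)%:R : R).
Proof.
move=> n0.
set L : R := (2 * n).-1`!%:R * (2 / pi ^+ (2 * n)) * zeta ((2 * n)%:R : R).
have p4 : 4 ^+ n != 1 :> R.
  by rewrite gt_eqF // exprn_egt1 ?ltr1n // -lt0n.
pose S M := csc_comb_sum R n M + csc_comb_sum R n 2 / (4 ^+ n - 1).
have S2 M : (0 < M)%N -> S (2 * M)%N = 4 ^+ n * S M.
  move=> M0; rewrite /S csc_comb_sum_double //; field.
  by rewrite subr_eq0.
have cvgS : S (2 * k.+1)%N / (2 * k.+1)%:R ^+ (2 * n) @[k --> \oo] --> L.
  rewrite -[X in _ --> X]addr0 -(mulr0 (csc_comb_sum R n 2 / (4 ^+ n - 1))).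
  rewrite (_ : (fun _ => _) = fun k =>
    csc_comb_sum R n (2 * k.+1) / (2 * k.+1)%:R ^+ (2 * n) +
    csc_comb_sum R n 2 / (4 ^+ n - 1) * (2 * k.+1)%:R^-1 ^+ (2 * n)).
    apply: cvgD.
      by rewrite /L -acoef_lead // -mulrA; exact: cvg_csc_comb_sum.
    by apply: cvgMr; apply: cvg_invr_exp; lia.
  by apply/funext => k; rewrite /S mulrDl exprVn.
(* The quotient is constant along 2^r M, and these arguments are cofinal in the convergent sequence.
   As that runs over 2(k+1), the index [(2 ^ K * M).-1] stands for the argument 2^{K+1} M. *)
have SE M : (0 < M)%N -> S M / M%:R ^+ (2 * n) = L.
  move=> M0.
  have SM r : S (2 ^ r * M)%N / (2 ^ r * M)%:R ^+ (2 * n) = S M / M%:R ^+ (2 * n).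
    elim: r => [|r IHr]; first by rewrite mul1n.
    have M1 : (2 ^ r * M)%:R != 0 :> R by rewrite pnatr_eq0 -lt0n muln_gt0 expn_gt0.
    rewrite expnS -mulnA S2 ?muln_gt0 ?expn_gt0 // -IHr natrM exprMn.
    rewrite (_ : 2 ^+ (2 * n) = 4 ^+ n :> R); last by rewrite exprM -natrX.
    by field; rewrite !expf_neq0 // pnatr_eq0.
  apply/eqP; rewrite -subr_eq0 -normr_le0; apply/ler_addgt0Pr => e e0; rewrite add0r.
  move/cvgrPdist_le : cvgS => /(_ e e0)[K _ /= /(_ (2 ^ K * M).-1)%N].
  rewrite prednK ?muln_gt0 ?expn_gt0 // mulnA -expnS SM distrC; apply.
  rewrite /= -ltnS prednK ?muln_gt0 ?expn_gt0 //.
  by rewrite (leq_trans (ltn_expl K (isT : 1 < 2)%N)) // leq_pmulr.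
move=> N0.
have C1 : csc_comb_sum R n 1 = 0 by rewrite /csc_comb_sum big_geq.
have := SE 1%N isT; rewrite /S C1 expr1n divr1 add0r => QE.
have := SE N N0; rewrite /S QE => H.
have Nn : N%:R ^+ (2 * n) != 0 :> R by rewrite expf_neq0 // pnatr_eq0 -lt0n.
move: H; rewrite -[RHS](mulfK Nn) => /(mulIf (invr_neq0 Nn)) H.
by rewrite -[LHS](addrK L) H /L; ring.
Qed.

Lemma zeta_cycle_zeta (R : realType) N n : (0 < N)%N -> (0 < n)%N ->
  (N%:R ^+ (2 * n) - 1) * zeta ((2 * n)%:R : R) =
    pi ^+ (2 * n) / (2 * (((2 * n).-1)`!)%:R) *
    \sum_(1 <= i < n.+1) acoef R n i * cycle_zeta N (i%:R : R).
Proof.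
move=> N0 n0; under eq_bigr => i _ do rewrite cycle_zetaE.
rewrite -csc_comb_sumE csc_comb_sum_zeta //.
have p0 : pi ^+ (2 * n) != 0 :> R by rewrite expf_neq0 // lt0r_neq0 // pi_gt0.
by field; rewrite p0 pnatr_eq0 -lt0n fact_gt0.
Qed.

(** * Laurent expansions *)

(** The geometric bound on the coefficients is carried along so that products converge by a direct
    estimate of the tail. *)
Definition power_series (R : realType) (f : R -> R) (a : nat -> R) : Prop :=
  exists C : R, 0 < C /\ (exists M : R, forall n, `|a n| <= M * C ^+ n) /\
  forall x : R, `|x| * C < 1 -> series (fun n => a n * x ^+ n) @ \oo --> f x.

Definition cauchy_prod (R : pzRingType) (a b : nat -> R) (n : nat) : R :=
  \sum_(i < n.+1) a i * b (n - i)%N.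

(** The n + 1 summands are absorbed by n + 1 <= 2^n, which keeps the bound geometric. *)
Lemma cauchy_prod_le (R : numDomainType) (a b : nat -> R) M1 M2 C n :
  0 < C -> (forall k, `|a k| <= M1 * C ^+ k) ->
  (forall k, `|b k| <= M2 * C ^+ k) ->
  `|cauchy_prod a b n| <= M1 * M2 * (2 * C) ^+ n.
Proof.
move=> C0 aM bM.
have M1_ge0 : 0 <= M1.
  by have := aM 0%N; rewrite expr0 mulr1; apply: le_trans.
have M2_ge0 : 0 <= M2.
  by have := bM 0%N; rewrite expr0 mulr1; apply: le_trans.
apply: (le_trans (ler_norm_sum _ _ _)).
apply: (@le_trans _ _ (\sum_(i < n.+1) M1 * M2 * C ^+ n)).
  apply: ler_sum => i _; rewrite normrM -[in leRHS](@subnKC i n) -1?ltnS //.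
  by rewrite exprD mulrACA ler_pM.
rewrite sumr_const card_ord -[leLHS]mulr_natl exprMn [leLHS]mulrCA.
rewrite ler_wpM2l ?mulr_ge0 //.
by rewrite ler_wpM2r ?exprn_ge0 ?(ltW C0) // -natrX ler_nat ltn_expl.
Qed.

(** The product of the n-th partial sums exceeds the n-th partial sum of the Cauchy product by terms
    of degree n to 2n - 1 only. There are n <= 2^n of them, whence 4C: one factor 2 for their
    number, one from the bound on the coefficients. *)
Lemma power_series_mul (R : realType) (f g : R -> R) a b :
  power_series f a -> power_series g b ->
  power_series (fun x => f x * g x) (cauchy_prod a b).
Proof.
move=> [C1 [C1_gt0 [[M1 aM] fa]]] [C2 [C2_gt0 [[M2 bM] gb]]].
pose C := Num.max C1 C2.
have C_gt0 : 0 < C by rewrite lt_max C1_gt0.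
have weaken (c : nat -> R) M D : 0 < D <= C -> (forall k, `|c k| <= M * D ^+ k) ->
    forall k, `|c k| <= M * C ^+ k.
  move=> /andP[D0 DC] cM k; apply: (le_trans (cM k)).
  have M0 : 0 <= M by have := cM 0%N; rewrite expr0 mulr1; apply: le_trans.
  by rewrite ler_wpM2l // lerXn2r // nnegrE ltW.
have {}aM : forall k, `|a k| <= M1 * C ^+ k.
  by apply: weaken aM; rewrite C1_gt0 le_max lexx.
have {}bM : forall k, `|b k| <= M2 * C ^+ k.
  by apply: weaken bM; rewrite C2_gt0 le_max lexx orbT.
have M_ge0 : 0 <= M1 * M2.
  have := aM 0%N; have := bM 0%N; rewrite !expr0 !mulr1 => H2 H1.
  by rewrite mulr_ge0 // (le_trans _ H1, le_trans _ H2).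
exists (4 * C); split; first by rewrite mulr_gt0.
split.
  exists (M1 * M2) => n; apply: (le_trans (cauchy_prod_le n C_gt0 aM bM)).
  rewrite ler_wpM2l // lerXn2r ?nnegrE ?mulr_ge0 ?(ltW C_gt0) // ler_pM2r // ler_nat //.
move=> x xC.
have xC0 : 0 <= `|x| * C by rewrite mulr_ge0 // ltW.
have fx : series (fun n => a n * x ^+ n) @ \oo --> f x.
  apply: fa; apply: le_lt_trans xC; rewrite ler_wpM2l //.
  by rewrite (@le_trans _ _ C) ?le_max ?lexx // ler_peMl ?(ltW C_gt0) // ler1n.
have gx : series (fun n => b n * x ^+ n) @ \oo --> g x.
  apply: gb; apply: le_lt_trans xC; rewrite ler_wpM2l //.
  by rewrite (@le_trans _ _ C) ?le_max ?lexx ?orbT // ler_peMl ?(ltW C_gt0) // ler1n.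
pose A n := \poly_(i < n) a i; pose B n := \poly_(i < n) b i.
have AE n : (A n).[x] = series (fun n => a n * x ^+ n) n.
  by rewrite horner_poly /series /= big_mkord.
have BE n : (B n).[x] = series (fun n => b n * x ^+ n) n.
  by rewrite horner_poly /series /= big_mkord.
have ABE n : (A n * B n).[x] = \sum_(0 <= k < n + n) (A n * B n)`_k * x ^+ k.
  rewrite big_mkord; apply: horner_coef_wide.
  apply: (leq_trans (size_polyMleq _ _)).
  by rewrite (leq_trans (leq_pred _)) // leq_add // size_poly.
have ABc n k : (k < n)%N -> (A n * B n)`_k = cauchy_prod a b k.
  move=> kn; rewrite coefM; apply: eq_bigr => i _.
  rewrite !coef_poly (leq_ltn_trans _ kn) ?(leq_ltn_trans _ kn) ?leq_subr //.
  by rewrite -ltnS.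
pose D n := (A n * B n).[x] - series (fun n => cauchy_prod a b n * x ^+ n) n.
have DE n : `|D n| <= M1 * M2 * (`|x| * (4 * C)) ^+ n.
  rewrite /D ABE (@big_cat_nat _ _ _ n) //=; last exact: leq_addr.
  rewrite /series /=.
  rewrite (eq_big_nat _ _ (F2 := fun k => cauchy_prod a b k * x ^+ k)); last first.
    by move=> k /andP[_ kn]; rewrite ABc.
  rewrite addrAC subrr add0r; apply: (le_trans (ler_norm_sum _ _ _)).
  apply: (@le_trans _ _ (\sum_(n <= k < n + n) M1 * M2 * (`|x| * (2 * C)) ^+ n)).
    apply: ler_sum_nat => k /andP[nk _]; rewrite normrM normrX.
    apply: (@le_trans _ _ (M1 * M2 * (`|x| * (2 * C)) ^+ k)).
      rewrite [(`|x| * _) ^+ _]exprMn [leRHS]mulrCA [leRHS]mulrC.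
      rewrite ler_wpM2r ?exprn_ge0 //.
      rewrite coefM.
      apply: (cauchy_prod_le (a := nth 0 (A n)) (b := nth 0 (B n))) => // i.
        by rewrite coef_poly; case: ifP => // _; rewrite normr0 (le_trans _ (aM i)).
      by rewrite coef_poly; case: ifP => // _; rewrite normr0 (le_trans _ (bM i)).
    rewrite ler_wpM2l // ler_wiXn2l //; lra.
  rewrite sumr_const_nat addnK -[leLHS]mulr_natl [leLHS]mulrCA ler_wpM2l //.
  rewrite (_ : `|x| * (4 * C) = 2 * (`|x| * (2 * C))); last by ring.
  rewrite [leRHS]exprMn ler_wpM2r ?exprn_ge0 //; first lra.
  by rewrite -natrX ler_nat ltnW // ltn_expl.
have D0 : D @ \oo --> 0.
  apply/norm_cvg0P; apply: (@squeeze_cvgr _ _ _ _ (cst 0)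
    (fun n => M1 * M2 * (`|x| * (4 * C)) ^+ n)).
  - by apply: nearW => n; rewrite normr_ge0 DE.
  - exact: cvg_cst.
  rewrite -[X in _ --> X](mulr0 (M1 * M2)); apply: cvgMr; apply: cvg_expr.
  by rewrite ger0_norm //; lra.
rewrite (_ : series _ = fun n => (A n).[x] * (B n).[x] - D n); last first.
  by apply/funext => n; rewrite /D hornerM; ring.
rewrite -[X in _ --> X]subr0; apply: cvgB => //; apply: cvgM.
  by under eq_fun do rewrite AE.
by under eq_fun do rewrite BE.
Qed.

Lemma series_delta (R : realType) (x : R) :
  series (fun n => (n == 0%N)%:R * x ^+ n) @ \oo --> (1 : R).
Proof.
rewrite -cvg_shiftS; rewrite (_ : (fun _ => _) = cst 1); first exact: cvg_cst.
apply/funext => n; rewrite /series /= big_nat_recl //= mul1r expr0 big1 ?addr0 //.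
by move=> i _; rewrite mul0r.
Qed.

(* recip_seq a n lists the first n + 1 coefficients of 1 / a, highest first,
   for a power series a with constant coefficient 1. *)
Fixpoint recip_seq (R : pzRingType) (a : nat -> R) (n : nat) : seq R :=
  if n is m.+1 then
    let s := recip_seq a m in - \sum_(i < n) a i.+1 * s`_i :: s
  else [:: 1].

Definition recip (R : pzRingType) (a : nat -> R) (n : nat) : R :=
  (recip_seq a n)`_0.

Lemma recip_seqE (R : pzRingType) (a : nat -> R) n i : (i <= n)%N ->
  (recip_seq a n)`_i = recip a (n - i).
Proof.
elim: n i => [|n IHn] [|i] //; rewrite ltnS => ni.
by rewrite subSS -IHn.
Qed.

Lemma recipS (R : pzRingType) (a : nat -> R) n :
  recip a n.+1 = - \sum_(i < n.+1) a i.+1 * recip a (n - i).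
Proof.
rewrite {1}/recip /=; congr (- _); apply: eq_bigr => i _.
by rewrite recip_seqE // -ltnS.
Qed.

Lemma cauchy_prod_recip (R : pzRingType) (a : nat -> R) n : a 0%N = 1 ->
  cauchy_prod a (recip a) n = (n == 0%N)%:R.
Proof.
move=> a0; rewrite /cauchy_prod big_ord_recl a0 mul1r subn0.
case: n => [|n]; first by rewrite big_ord0 addr0.
rewrite recipS /= addrC; apply/eqP; rewrite subr_eq0; apply/eqP.
by apply: eq_bigr => i _; rewrite /bump /= add1n subSS.
Qed.

Lemma recip_le (R : numDomainType) (a : nat -> R) n :
  (forall k, `|a k| <= 1) -> `|recip a n| <= 2 ^+ n.
Proof.
move=> a1; elim/ltn_ind: n => -[|n] IHn; first by rewrite normr1 expr0.
rewrite recipS normrN (le_trans (ler_norm_sum _ _ _)) //.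
apply: (@le_trans _ _ (\sum_(i < n.+1) 2 ^+ (n - i))).
  apply: ler_sum => i _; rewrite normrM -[leRHS]mul1r ler_pM //.
  by apply: IHn; rewrite ltnS leq_subr.
rewrite (reindex_inj rev_ord_inj) /=.
under eq_bigr => i _ do rewrite subSS (subKn (_ : i <= n)%N) -1?ltnS //.
elim: n.+1 => [|k IHk]; first by rewrite big_ord0.
rewrite big_ord_recr /= exprS (le_trans (lerD IHk (lexx _))) //.
by rewrite mulr_natl mulr2n.
Qed.

(** The sum g of the reciprocal series converges by comparison with a geometric series, and f g = 1
    by uniqueness of limits. This also shows that f has no zero in the disc. *)
Lemma power_series_recip (R : realType) (f : R -> R) a :
  power_series f a -> a 0%N = 1 -> (forall k, `|a k| <= 1) ->
  power_series (fun x => (f x)^-1) (recip a).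
Proof.
move=> fa a0 a1.
pose g (x : R) := limn (series (fun n => recip a n * x ^+ n)).
have gb : power_series g (recip a).
  exists 2; split=> //; split.
    by exists 1 => n; rewrite mul1r recip_le.
  move=> x x2; apply: normed_cvg.
  apply: (@series_le_cvg _ _ (fun n => (`|x| * 2) ^+ n)) => [n|n|n|].
  - exact: normr_ge0.
  - by rewrite exprn_ge0 // mulr_ge0.
  - by rewrite /= normrM normrX exprMn mulrC ler_wpM2l ?exprn_ge0 // recip_le.
  have := @is_cvg_geometric_series R 1 (`|x| * 2).
  rewrite ger0_norm ?mulr_ge0 // => /(_ x2).
  rewrite (_ : geometric _ _ = fun n => (`|x| * 2) ^+ n) //.
  by apply/funext => n; rewrite /geometric /= mul1r.
have [C [C0 [aM fg]]] := power_series_mul fa gb.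
have [D [D0 [bM gD]]] := gb.
pose E := Num.max C D; have E0 : 0 < E by rewrite lt_max C0.
exists E; split=> //; split.
  have [M bE] := bM; exists M => n; rewrite (le_trans (bE n)) //.
  have M0 : 0 <= M by have := bE 0%N; rewrite expr0 mulr1; apply: le_trans.
  by rewrite ler_wpM2l // lerXn2r ?nnegrE ?(ltW D0) ?(ltW E0) // le_max lexx orbT.
move=> x xE.
have xC : `|x| * C < 1 by rewrite (le_lt_trans _ xE) // ler_wpM2l // le_max lexx.
have xD : `|x| * D < 1 by rewrite (le_lt_trans _ xE) // ler_wpM2l // le_max lexx orbT.
have fg1 : f x * g x = 1.
  apply: (norm_cvg_unique (fg x xC)); rewrite /=.
  rewrite (_ : (fun _ => _) = fun n => (n == 0%N)%:R * x ^+ n).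
    exact: series_delta.
  by apply/funext => n; rewrite cauchy_prod_recip.
have f0 : f x != 0.
  by apply/eqP => f0; move: fg1; rewrite f0 mul0r => /esym/eqP; rewrite oner_eq0.
by rewrite -(mulr1 (f x)^-1) -fg1 mulKf //; exact: gD.
Qed.

Definition sinc (R : realType) (x : R) : R := if x == 0 then 1 else sin x / x.

Definition sinc_coef (R : realType) (n : nat) : R :=
  (odd n.+1)%:R * (-1) ^+ n./2 / n.+1`!%:R.

Lemma sinc_coef_le1 (R : realType) n : `|sinc_coef R n| <= 1.
Proof.
rewrite /sinc_coef !normrM normrX normrN1 expr1n mulr1 normfV !normr_nat.
rewrite -[leRHS]mul1r ler_pM ?invr_ge0 ?ler0n //; first by case: odd.
by rewrite invf_le1 ?ltr0n ?fact_gt0 // ler1n fact_gt0.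
Qed.

Lemma sinc_coef0 (R : realType) : sinc_coef R 0 = 1.
Proof. by rewrite /sinc_coef (_ : 1`! = 1%N) // divr1 mul1r expr0. Qed.

Lemma power_series_sinc (R : realType) : power_series (@sinc R) (sinc_coef R).
Proof.
exists 1; split=> //; split.
  by exists 1 => n; rewrite expr1n mulr1 sinc_coef_le1.
move=> x _; rewrite /sinc; have [->|x0] := eqVneq x 0.
  rewrite (_ : (fun _ => _) = fun n => (n == 0%N)%:R * 0 ^+ n).
    exact: series_delta.
  apply/funext => -[|n]; last by rewrite exprS !mul0r !mulr0.
  by rewrite sinc_coef0 expr0.
have H : series (sin_coeff x) @ \oo --> sin x.
  by rewrite unlock; exact: is_cvg_series_sin_coeff.
rewrite -cvg_shiftS in H.
rewrite (_ : series _ = fun n => series (sin_coeff x) n.+1 / x); last first.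
  apply/funext => n; rewrite /series /= big_nat_recl //.
  rewrite [sin_coeff x 0%N](_ : _ = 0) ?add0r; last by rewrite /sin_coeff /= !mul0r.
  rewrite mulr_suml; apply: eq_bigr => i _.
  have : i.+1`!%:R != 0 :> R by rewrite pnatr_eq0 -lt0n fact_gt0.
  rewrite /sinc_coef /sin_coeff /=; move: (i.+1`!%:R) => q q0.
  by rewrite exprS; field; rewrite q0 x0.
by apply: cvgMl.
Qed.

Fixpoint cauchy_exp (R : pzRingType) (a : nat -> R) (m : nat) : nat -> R :=
  if m is k.+1 then cauchy_prod a (cauchy_exp a k) else fun n => (n == 0%N)%:R.

Lemma power_series_exp (R : realType) (f : R -> R) a m :
  power_series f a -> power_series (fun x => f x ^+ m) (cauchy_exp a m).
Proof.
move=> fa; elim: m => [|m IHm].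
  exists 1; split=> //; split; last by move=> x _; exact: series_delta.
  by exists 1 => n; rewrite expr1n mulr1 normr_nat; case: eqP.
by under eq_fun do rewrite exprS; exact: power_series_mul.
Qed.

Lemma cauchy_exp0 (R : pzRingType) (a : nat -> R) m :
  a 0%N = 1 -> cauchy_exp a m 0%N = 1.
Proof.
by move=> a0; elim: m => //= m IHm; rewrite /cauchy_prod big_ord1 subnn a0 IHm mul1r.
Qed.

(** csc^n x is x^{-n} times the n-th power of x / sin x, a power series with constant term 1. *)
Lemma laurent_csc (R : realType) n : exists b : int -> R,
  [/\ is_laurent (fun x : R => sin x ^- n) b, b (- n%:Z) = 1 &
      forall k, k < - n%:Z -> b k = 0].
Proof.
have := power_series_exp n (power_series_recip (power_series_sinc R)
  (sinc_coef0 R) (@sinc_coef_le1 R)).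
set e := cauchy_exp _ _ => -[C [C0 [_ eE]]].
exists (fun k => if k < - n%:Z then 0 else e (absz (k + n%:Z))); split.
- exists n; split; first by move=> k ->.
  exists C^-1; first by rewrite invr_gt0.
  move=> x /andP[x0 xC]; rewrite normr_gt0 in x0.
  rewrite (_ : series _ = fun m => x ^- n * series (fun k => e k * x ^+ k) m).
    rewrite (_ : sin x ^- n = x ^- n * (sinc x)^-1 ^+ n).
      by apply: cvgMr; apply: eE; rewrite -ltr_pdivlMr // mul1r.
    rewrite /sinc (negbTE x0) exprVn expr_div_n invf_div mulrA.
    by rewrite mulVf ?expf_neq0 // mul1r.
  apply/funext => m; rewrite /series /= mulr_sumr; apply: eq_bigr => k _.
  rewrite ltNge lerBrDl subrr lez_nat /= subrK absz_nat expfzDr //.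
  by rewrite exprnN exprnP [LHS]mulrA [LHS]mulrC [e k * _]mulrC.
- by rewrite Order.POrderTheory.ltxx addNr /e cauchy_exp0.
by move=> k ->.
Qed.

(** * Principal parts at 0 *)

Lemma poly_bounded_const (R : realFieldType) (p : {poly R}) (M Y : R) :
  (forall y, Y < y -> `|p.[y]| <= M) -> (size p <= 1)%N.
Proof.
elim/poly_ind: p M Y => [|p c IHp] M Y pM; first by rewrite size_poly0.
have Y1 y : Num.max Y 1 < y -> Y < y /\ 1 < y by rewrite gt_max => /andP[].
have pyM y : Num.max Y 1 < y -> `|p.[y] * y| <= M + `|c|.
  move=> /Y1[yY _]; have := pM y yY; rewrite hornerMXaddC => H.
  by rewrite -[_ * y](addrK c) (le_trans (ler_normB _ _)) // lerD2r.
(* For y > 1 a bound on p(y) y bounds p(y), so p is constant by induction; unless it is zero, p(y) y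
   is unbounded. *)
have /IHp : forall y, Num.max Y 1 < y -> `|p.[y]| <= M + `|c|.
  move=> y yY; rewrite (le_trans _ (pyM y yY)) // normrM ler_peMr //.
  by have /Y1[_ y1] := yY; rewrite ger0_norm; lra.
move=> /size1_polyC pE.
suff -> : p = 0 by rewrite mul0r add0r size_polyC; case: eqP.
rewrite pE; have [->|p0] := eqVneq p`_0 0; first by rewrite polyC0.
pose y := Num.max Y 1 + 1 + (M + `|c|) / `|p`_0|.
have p0' : 0 < `|p`_0| by rewrite normr_gt0.
have MC : 0 <= M + `|c|.
  by apply: le_trans (pyM (Num.max Y 1 + 1) _); rewrite ?normr_ge0 // ltrDl.
have yY : Num.max Y 1 < y by rewrite /y -addrA ltrDl ltr_pwDl // divr_ge0.
have y1 : 1 < y by have /Y1[] := yY.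
have : (M + `|c|) / `|p`_0| < y.
  have : 1 <= Num.max Y 1 by rewrite le_max lexx orbT.
  by rewrite /y; lra.
rewrite ltr_pdivrMr // mulrC ltNge; have := pyM y yY.
by rewrite pE hornerC coefC /= normrM (gtr0_norm (lt_trans ltr01 y1)) => ->.
Qed.

(** Boundedness replaces an expansion: it is stable under linear combinations, asks nothing of the
    regular part, and still determines [q], even from one side of 0. *)
Definition principal_part (R : realType) (f : R -> R) (q : {poly R}) : Prop :=
  q`_0 = 0 /\ exists2 r : R, 0 < r &
  exists M : R, forall x : R, 0 < x < r -> `|f x - q.[x^-1]| <= M.

Lemma principal_part_unique (R : realType) (f : R -> R) p q :
  principal_part f p -> principal_part f q -> p = q.
Proof.
move=> [p0 [r r0 [M fp]]] [q0 [s s0 [L fq]]].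
have pq : (size (p - q)%R <= 1)%N.
  pose t := Num.min r s; have t0 : 0 < t by rewrite lt_min r0.
  apply: (@poly_bounded_const _ _ (M + L) t^-1) => y ty.
  have y0 : 0 < y by apply: lt_trans ty; rewrite invr_gt0.
  have : y^-1 < t by rewrite -[t]invrK ltf_pV2 // ?posrE invr_gt0.
  rewrite lt_min => /andP[yr ys].
  have := fp y^-1; have := fq y^-1; rewrite !invr_gt0 y0 yr ys invrK => Hq Hp.
  rewrite hornerD hornerN distrC.
  rewrite (_ : _ - _ = (f y^-1 - p.[y]) - (f y^-1 - q.[y])); last by ring.
  by rewrite (le_trans (ler_normB _ _)) // lerD ?Hp ?Hq.
apply/eqP; rewrite -subr_eq0 (size1_polyC pq) coefB p0 q0 subr0 polyC0 //.
Qed.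

Lemma principal_part0 (R : realType) : principal_part (fun _ : R => 0) 0.
Proof.
split; first by rewrite coef0.
by exists 1 => //; exists 0 => x _; rewrite horner0 subr0 normr0.
Qed.

Lemma principal_partD (R : realType) (f g : R -> R) p q :
  principal_part f p -> principal_part g q ->
  principal_part (fun x => f x + g x) (p + q).
Proof.
move=> [p0 [r r0 [M fp]]] [q0 [s s0 [L gq]]]; split.
  by rewrite coefD p0 q0 addr0.
exists (Num.min r s); first by rewrite lt_min r0.
exists (M + L) => x; rewrite lt_min => /andP[x0 /andP[xr xs]].
rewrite hornerD opprD addrACA (le_trans (ler_normD _ _)) //.
by rewrite lerD ?fp ?gq ?x0.
Qed.

Lemma principal_partZ (R : realType) (f : R -> R) p c :
  principal_part f p -> principal_part (fun x => c * f x) (c *: p).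
Proof.
move=> [p0 [r r0 [M fp]]]; split; first by rewrite coefZ p0 mulr0.
exists r => //; exists (`|c| * M) => x xr.
by rewrite hornerZ -mulrBr normrM ler_wpM2l // fp.
Qed.

Lemma principal_part_sum (R : realType) (f : nat -> R -> R)
    (p : nat -> {poly R}) c m n :
  (forall i, (m <= i < n)%N -> principal_part (f i) (p i)) ->
  principal_part (fun x => \sum_(m <= i < n) c i * f i x)
    (\sum_(m <= i < n) c i *: p i).
Proof.
move=> fp; rewrite big_nat; under eq_fun do rewrite big_nat.
rewrite (_ : (fun _ => _) =
  \sum_(m <= i < n | (m <= i < n)%N) (fun x => c i * f i x)); last first.
  by apply/funext => x; rewrite fct_sumE.
apply: (big_ind2 (fun (g : R -> R) q => principal_part g q)).
- exact: principal_part0.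
- by move=> g1 q1 g2 q2; exact: principal_partD.
by move=> i mn; apply: principal_partZ; apply: fp.
Qed.

(** Convergence at x0 = r/2 bounds the terms there by some B; for 0 < x < x0/2 the terms of
    nonnegative exponent are then dominated by B 2^{-j}, and the regular part by 2B. *)
Lemma is_laurent_principal_part (R : realType) (f : R -> R) (b : int -> R) :
  is_laurent f b -> exists2 q : {poly R}, principal_part f q &
    forall k : nat, (0 < k)%N -> q`_k = b (- k%:Z).
Proof.
move=> [p [bp [r r0 fr]]].
pose q := \poly_(k < p.+1) (if k == 0%N then 0 else b (- k%:Z)).
exists q; last first.
  move=> k k0; rewrite coef_poly; case: ifP => [_|]; first by rewrite gtn_eqF.
  by move=> /negbT; rewrite -leqNgt => pk; rewrite bp // ltrN2 ltz_nat.
split; first by rewrite coef_poly eqxx.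
pose x0 := r / 2; have x0_gt0 : 0 < x0 by rewrite divr_gt0.
have /fr cvg0 : 0 < `|x0| < r.
  by rewrite gtr0_norm // x0_gt0 /x0; lra.
have [B Bge] : exists B : R,
    forall j : nat, `|b (j%:Z - p%:Z) * x0 ^ (j%:Z - p%:Z)| <= B.
  have /cvg_series_bounded := cvgP _ cvg0.
  case=> M0 [_ HM]; exists (M0 + 1) => j.
  by apply: (HM (M0 + 1)); rewrite ?ltrDl.
exists (x0 / 2); first by rewrite divr_gt0.
exists (2 * B) => x /andP[x_gt0 xx0].
have /fr cvgx : 0 < `|x| < r.
  by rewrite gtr0_norm // x_gt0 /=; rewrite /x0 in xx0; lra.
have qE : q.[x^-1] = series (fun j : nat => b (j%:Z - p%:Z) * x ^ (j%:Z - p%:Z)) p.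
  rewrite /q horner_poly big_ord_recl /= mul0r add0r /series /= big_mkord.
  rewrite (reindex_inj rev_ord_inj) /=; apply: eq_bigr => i _.
  rewrite /bump /= add1n (_ : i%:Z - p%:Z = - ((p - i.+1).+1)%:Z).
    by rewrite -exprnN exprVn.
  by have := ltn_ord i; lia.
have B0 : 0 <= B by apply: le_trans (Bge 0%N).
have tail n : (p <= n)%N ->
  `|series (fun j : nat => b (j%:Z - p%:Z) * x ^ (j%:Z - p%:Z)) n - q.[x^-1]|
  <= 2 * B.
  move=> pn; rewrite qE sub_series_geq // (le_trans (ler_norm_sum _ _ _)) //.
  apply: (@le_trans _ _ (\sum_(p <= j < n) B * 2^-1 ^+ (j - p))).
    apply: ler_sum_nat => j /andP[pj _].
    rewrite {1}(_ : x = x0 * (x / x0)); last by field; rewrite lt0r_neq0.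
    rewrite exprzMl ?unitfE ?mulf_neq0 ?invr_eq0 ?lt0r_neq0 // mulrA normrM ler_pM //.
    rewrite (_ : j%:Z - p%:Z = (j - p)%N%:Z); last by lia.
    rewrite -exprnP normrX lerXn2r ?nnegrE ?invr_ge0 //.
    by rewrite ger0_norm ?divr_ge0 ?ltW // ltr_pdivrMr // mulrC.
  rewrite -{1}(add0n p) big_addn big_mkord; under eq_bigr do rewrite addnK.
  rewrite -mulr_sumr mulrC ler_wpM2r //.
  rewrite (_ : \sum_(i < _) _ = 2 - 2 * 2^-1 ^+ (n - p)).
    by rewrite gerBl mulr_ge0 // exprn_ge0 // invr_ge0.
  elim: (n - p)%N => [|m IHm]; first by rewrite big_ord0 expr0 mulr1 subrr.
  by rewrite big_ord_recr /= IHm exprS; field.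
apply/ler_addgt0Pr => e e0.
move/cvgrPdist_le : cvgx => /(_ e e0)[K _ HK].
have := HK (maxn K p) (leq_maxl _ _); have := tail _ (leq_maxr K p).
set u := series _ _ => t1 t2.
rewrite (_ : f x - _ = (u - q.[x^-1]) + (f x - u)); last by ring.
by rewrite (le_trans (ler_normD _ _)) // lerD.
Qed.

(** [laurent_coef] is a chosen expansion, while the leading 1 and the vanishing beyond it are known
    for the one built in [laurent_csc]. Uniqueness of the principal part identifies their
    coefficients of negative exponent. *)
Lemma csc_principal_part (R : realType) n : exists q : {poly R},
  [/\ principal_part (fun x => sin x ^- (2 * n)) q,
      forall i, (0 < i)%N -> q`_(2 * i) = csc_coef R n i,
      (0 < n)%N -> q`_(2 * n) = 1 & forall k, (2 * n < k)%N -> q`_k = 0].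
Proof.
have [b [bL bn bk]] := laurent_csc R (2 * n).
have [q qpp qE] := is_laurent_principal_part bL.
have cL : is_laurent (fun x : R => sin x ^- (2 * n))
    (laurent_coef (fun x : R => sin x ^- (2 * n))).
  by apply: (@xgetPex _ _ [set b | is_laurent _ b]); exists b.
have [q' q'pp q'E] := is_laurent_principal_part cL.
exists q; split => //.
- move=> i i0; rewrite (principal_part_unique qpp q'pp) q'E ?muln_gt0 //.
- by move=> n0; rewrite qE ?muln_gt0.
by move=> k nk; rewrite qE ?bk ?ltrN2 ?ltz_nat // (leq_ltn_trans _ nk).
Qed.

(** Since f_n(x + pi/2) is bounded near 0, doubling makes q(y) - 4^n q(y/2) bounded for large y,
    hence zero. Its k-th coefficient is q_k (1 - 4^n/2^k), and the bracket vanishes only for k =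
    2n. *)
Lemma csc_comb_principal_part (R : realType) n (q : {poly R}) k : (0 < n)%N ->
  principal_part (csc_comb n) q -> k != (2 * n)%N -> q`_k = 0.
Proof.
move=> n0 [q0 [r r0 [M fq]]] kn.
pose t := \poly_(j < size q) (q`_j * (1 - 4 ^+ n / 2 ^+ j)).
have tE y : t.[y] = q.[y] - 4 ^+ n * q.[y / 2].
  rewrite /t horner_poly !horner_coef mulr_sumr -sumrB; apply: eq_bigr => j _.
  by rewrite expr_div_n; ring.
have t0 : t`_0 = 0 by rewrite coef_poly q0 mul0r; case: ifP.
pose B := \sum_(1 <= i < n.+1) `|acoef R n i| * 2 ^+ i.
have tB : (size t <= 1)%N.
  (* The bound r/2 keeps 2x below r; x < 1/2 gives sin x <= 1/2, so sec^2 x <= 2, which yields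
     [B]. *)
  pose d := Num.min (r / 2) 2^-1.
  have d0 : 0 < d by rewrite lt_min divr_gt0 //= invr_gt0.
  apply: (@poly_bounded_const _ _ (M + B + 4 ^+ n * M) d^-1) => y dy.
  have y0 : 0 < y by apply: lt_trans dy; rewrite invr_gt0.
  pose x := y^-1; have x0 : 0 < x by rewrite invr_gt0.
  have : x < d by rewrite -[d]invrK ltf_pV2 // ?posrE invr_gt0.
  rewrite lt_min => /andP[xr xh].
  have sx : 0 < sin x by apply: sin_gt0_pi; have := pi_ge2 R; lra.
  have cx : 0 < cos x by apply: cos_gt0_pihalf; have := pihalf_ge1 R; lra.
  have c2 : 0 <= cos x ^- 2 <= 2.
    rewrite invr_ge0 exprn_ge0 ?(ltW cx) //= -[leRHS]invrK.
    rewrite lef_pV2 ?posrE ?invr_gt0 ?exprn_gt0 //.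
    rewrite cos2sin2; have : sin x ^+ 2 <= 2^-1 ^+ 2.
      rewrite lerXn2r ?nnegrE ?(ltW sx) ?invr_ge0 //.
      rewrite (le_trans (sin_le_id (ltW x0))) //.
      exact: ltW.
    by rewrite expr2; lra.
  have fB : `|csc_comb n (x + pi / 2)| <= B.
    rewrite /csc_comb sinDpihalf (le_trans (ler_norm_sum _ _ _)) //.
    apply: ler_sum => i _.
    rewrite normrM ler_wpM2l // ger0_norm ?exprn_ge0 //; last by case/andP: c2.
    by case/andP: c2 => c20 c22; rewrite lerXn2r ?nnegrE.
  have := csc_comb_doubling n0 (lt0r_neq0 sx) (lt0r_neq0 cx).
  have : `|csc_comb n x - q.[y]| <= M by rewrite -[y]invrK fq // x0 /=; lra.
  have : `|csc_comb n (2 * x) - q.[y / 2]| <= M.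
    rewrite (_ : y / 2 = (2 * x)^-1); last by rewrite invfM invrK mulrC.
    by rewrite fq //; lra.
  move: (csc_comb n x) (csc_comb n (2 * x)) (csc_comb _ _) fB => f1 f2 f3 f3B H2 H1 E.
  rewrite tE (_ : _ - _ = (4 ^+ n * (f2 - q.[y / 2])) - (f1 - q.[y]) - f3); last first.
    by rewrite mulrBr -E; ring.
  rewrite (le_trans (ler_normB _ _)) // (le_trans (lerD (ler_normB _ _) (lexx _))) //.
  rewrite normrM (ger0_norm (exprn_ge0 n _)) //.
  have : 4 ^+ n * `|f2 - q.[y / 2]| <= 4 ^+ n * M by rewrite ler_wpM2l // exprn_ge0.
  lra.
have /polyP/(_ k) : t = 0 by rewrite (size1_polyC tB) t0 polyC0.
rewrite coef0 coef_poly; case: ltnP => [_|kq _]; last by rewrite nth_default.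
move=> /eqP; rewrite mulf_eq0 => /orP[/eqP //|].
rewrite subr_eq0 => /eqP E; exfalso; move: kn.
have : 2 ^+ k = 2 ^+ (2 * n) :> R.
  by rewrite -(divr1_eq (esym E)) exprM (_ : 2 ^+ 2 = 4 :> R) // -natrX.
by rewrite -!natrX => /eqP; rewrite eqr_nat eqn_exp2l // => ->.
Qed.

(** * Inversion of the triangular coefficient matrices *)

Lemma sum_acoef_csc_coef (R : realType) n i : (0 < n)%N -> (0 < i)%N ->
  \sum_(1 <= j < n.+1) acoef R n j * csc_coef R j i =
  if i == n then acoef R n n else 0.
Proof.
move=> n0 i0.
have [q qP] := choice (csc_principal_part R).
have pp : principal_part (csc_comb n) (\sum_(1 <= j < n.+1) acoef R n j *: q j).
  have := @principal_part_sum R (fun j x => sin x ^- (2 * j)) q (acoef R n) 1 n.+1.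
  rewrite (_ : (fun _ => _) = @csc_comb R n); first by apply=> j _; have [] := qP j.
  by apply/funext => x; apply: eq_bigr => j _; rewrite exprVn -exprM.
have coefE k : (\sum_(1 <= j < n.+1) acoef R n j *: q j)`_k =
    \sum_(1 <= j < n.+1) acoef R n j * (q j)`_k.
  by rewrite coef_sum; apply: eq_bigr => j _; rewrite coefZ.
have -> : \sum_(1 <= j < n.+1) acoef R n j * csc_coef R j i =
    (\sum_(1 <= j < n.+1) acoef R n j *: q j)`_(2 * i).
  rewrite coefE; apply: eq_bigr => j _.
  by have [_ <-] := qP j.
case: eqP => [->|/eqP ni]; last first.
  by rewrite (csc_comb_principal_part n0 pp) // eqn_pmul2l.
rewrite coefE big_nat_recr //= big1_seq ?add0r; last first.
  move=> j; rewrite mem_index_iota => /andP[_ /andP[_ jn]].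
  by have [_ _ _ ->] := qP j; rewrite ?mulr0 // ltn_pmul2l.
by have [_ _ -> //] := qP n; rewrite mulr1.
Qed.

Lemma csc_coef_gt (R : realType) n i : (n < i)%N -> csc_coef R n i = 0.
Proof.
move=> ni; have [q [_ qE _ q0]] := csc_principal_part R n.
by rewrite -qE ?(leq_ltn_trans _ ni) // q0 // ltn_pmul2l.
Qed.

(** Forward substitution instead of a matrix inverse: the first identity is solved for its top term
    i = n, the lower ones being known by strong induction, and the orthogonality relation collects
    the coefficients. *)
Lemma cycle_zeta_zeta (R : realType) N n : (0 < N)%N -> (0 < n)%N ->
  cycle_zeta N (n%:R : R) =
    2 * \sum_(1 <= i < n.+1)
          csc_coef R n i * ((N%:R ^+ (2 * i) - 1) / pi ^+ (2 * i))
          * zeta ((2 * i)%:R : R).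
Proof.
move=> N0; rewrite cycle_zetaE; elim/ltn_ind: n => n IHn n0.
pose E i : R := (N%:R ^+ (2 * i) - 1) / pi ^+ (2 * i) * zeta ((2 * i)%:R : R).
(* The sums are prolonged by zero coefficients to a range independent of j, so that the two
   summations can be exchanged. *)
have SE j m : (0 < j <= m)%N -> (j < n)%N ->
    cycle_sum R j N = 2 * \sum_(1 <= i < m.+1) csc_coef R j i * E i.
  move=> /andP[j0 jm] jn; rewrite IHn //; congr (_ * _).
  rewrite [RHS](@big_cat_nat _ _ _ j.+1) //= [X in _ = _ + X]big1_seq ?addr0.
    by apply: eq_bigr => i _; rewrite /E [RHS]mulrA.
  move=> i; rewrite mem_index_iota => /andP[_ /andP[ji _]].
  by rewrite csc_coef_gt // mul0r.
have an : acoef R n n != 0 by rewrite acoef_lead // pnatr_eq0 -lt0n fact_gt0.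
have QE := csc_comb_sum_zeta R n0 N0.
have := csc_comb_sumE R n N; rewrite QE big_nat_recr //=.
rewrite (eq_big_nat _ _ (F2 := fun j =>
  \sum_(1 <= i < n.+1) 2 * (acoef R n j * csc_coef R j i) * E i)); last first.
  move=> j /andP[j0 jn]; rewrite (SE j n) ?j0 ?(ltnW jn) //.
  by rewrite !mulr_sumr; apply: eq_bigr => i _; ring.
rewrite exchange_big /=.
rewrite (eq_big_nat _ _ (F2 := fun i => 2 * (if i == n then acoef R n n else 0) * E i
    - 2 * acoef R n n * csc_coef R n i * E i)); last first.
  move=> i /andP[i0 _]; rewrite -mulr_suml -mulr_sumr -(sum_acoef_csc_coef R n0 i0).
  by rewrite [in RHS]big_nat_recr //=; ring.
rewrite sumrB big_nat_recr //= eqxx big1_seq ?add0r; last first.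
  move=> i; rewrite mem_index_iota => /andP[_ /andP[_ jn]].
  by rewrite ltn_eqF // mulr0 mul0r.
rewrite (_ : _ * _ * _ * _ = 2 * acoef R n n * E n); last first.
  by rewrite /E acoef_lead //; ring.
move=> H; apply: (mulfI an).
transitivity (\sum_(1 <= i < n.+1) 2 * acoef R n n * csc_coef R n i * E i).
  move: H; move: (\sum_(1 <= i < _) _) (_ * E n) (_ * cycle_sum R n N).
  by move=> s t u; lra.
by rewrite !mulr_sumr; apply: eq_bigr => i _; rewrite /E; ring.
Qed.

End Analysis.

Theorem theorem2 (R : realType) (N n : nat) (hN : (2 <= N)%N) (hn : (1 <= n)%N) :
  (N%:R ^+ (2 * n) - 1) * zeta ((2 * n)%:R : R) =
    pi ^+ (2 * n) / (2 * (((2 * n).-1)`!)%:R) *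
    \sum_(1 <= i < n.+1) acoef R n i * cycle_zeta N (i%:R : R)
  /\
  cycle_zeta N (n%:R : R) =
    2 * \sum_(1 <= i < n.+1)
          csc_coef R n i * ((N%:R ^+ (2 * i) - 1) / pi ^+ (2 * i))
          * zeta ((2 * i)%:R : R).
Proof.
have N0 : (0 < N)%N by exact: leq_trans hN.
by split; [exact: zeta_cycle_zeta|exact: cycle_zeta_zeta].
Qed.
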